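(* Let $\lambda$ be a Perron number of algebraic degree $d \geq 3$ and spectral ratio $\rho$. Set $\mathbb{K} := \mathbb{Q}(\lambda)$, let $\mathcal{O}_\mathbb{K}$ be its ring of integers, and let $D_\mathbb{K}$ and $\tau_{\min}(\mathcal{O}_\mathbb{K})$ denote respectively the discriminant and the minimal Hermite-like thickness of $\mathbb{K}$. Then $d_{PF}^{irr}(\lambda)$ is bounded above by each of \[ \Big(\dfrac{8d}{1-\rho}\Big)^{d^2} \tau_{\min}(\mathcal{O}_\mathbb{K})^{\frac{d}{2}} \quad\text{and}\quad \Big(\dfrac{8d}{1-\rho}\Big)^{d^2} \sqrt{D_\mathbb{K}}. \]
   Context: A real algebraic integer $\lambda \geq 1$ is Perron if it is strictly larger in absolute value than all its other Galois conjugates. The spectral ratio of a Perron number $\lambda$ is $\max_i |\lambda_i|/\lambda$, the maximum over the Galois conjugates $\lambda_i \neq \lambda$. A non-negative real square matrix $A$ is irreducible if for all indices $i,j$ there is a natural number $k$ with $(A^k)_{ij}>0$. $d_{PF}^{irr}(\lambda)$ denotes the smallest dimension of a square non-negative integral irreducible matrix with spectral radius $\lambda$. Discriminant: if $\omega_1,\dots,\omega_d$ is a $\mathbb{Z}$-basis of $\mathcal{O}_\mathbb{K}$ and $\sigma_1,\dots,\sigma_d$ are all embeddings of $\mathbb{K}$ into $\mathbb{C}$, $D_\mathbb{K}$ is the square of $\det(\sigma_i(\omega_j))$. Minimal Hermite-like thickness: let $\sigma_1,\dots,\sigma_r$ be the real embeddings of $\mathbb{K}$ and $\sigma_{r+1},\bar\sigma_{r+1},\dots,\sigma_{r+s},\bar\sigma_{r+s}$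 the pairs of complex conjugate embeddings ($r+2s=d$). Via $x\mapsto(\sigma_1(x),\dots,\sigma_{r+s}(x))$ identify $\mathbb{K}_\mathbb{R}:=\mathbb{K}\otimes_\mathbb{Q}\mathbb{R}$ with $\mathbb{R}^r\times\mathbb{C}^s\cong\mathbb{R}^d$, so $\mathcal{O}_\mathbb{K}$ is a full-rank lattice. Let $\mathfrak{B}$ be the set of $\alpha=(\alpha_1,\dots,\alpha_{r+s})\in\mathbb{R}^r\times\mathbb{C}^s$ with $\alpha=\bar\alpha$ and all components positive real. For $\alpha\in\mathfrak{B}$ let $q_\alpha(x,y)=\mathrm{Trace}(\alpha x\bar y)$ (componentwise product; $\mathrm{Trace}(x_1,\dots,x_{r+s})=\sum_{i\le r}x_i+\sum_{j>r}(x_j+\bar x_j)$), so $q_\alpha(x,x)=\sum_{i=1}^r\alpha_i|\sigma_i(x)|^2+2\sum_{j=r+1}^{r+s}\alpha_j|\sigma_j(x)|^2$. Define $\max(\mathcal{O}_\mathbb{K},q_\alpha)=\inf\{u\in\mathbb{R} : \forall x\in\mathbb{K}_\mathbb{R}\ \exists y\in\mathcal{O}_\mathbb{K},\ q_\alpha(x-y,x-y)\le u\}$, and $\det(\mathcal{O}_\mathbb{K},q_\alpha)=\det(q_\alpha(\omega_i,\omega_j))$ for a $\mathbb{Z}$-basis $\omega_i$ of $\mathcal{O}_\mathbb{K}$. The Hermite-like thickness is $\tau(\mathcal{O}_\mathbb{K},q_\alpha)=\max(\mathcal{O}_\mathbb{K},q_\alpha)/\det(\mathcal{O}_\mathbb{K},q_\alpha)^{1/d}$,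 and $\tau_{\min}(\mathcal{O}_\mathbb{K})=\inf\{\tau(\mathcal{O}_\mathbb{K},q_\alpha):\alpha\in\mathfrak{B}\}$.
   Formalization: The second bound is stated with the square root of |D_K| in place of the square root of D_K, because D_K is negative when K has an odd number of pairs of complex embeddings (for example, D_K = -23 for the root λ of x^3 - x - 1). *)

(* Defs.v *)
(* MathComp + MathComp-Analysis (R : realType), complex numbers R[i]
   from mathcomp-real-closed. *)
From HB Require Import structures.
From mathcomp Require Import all_boot all_order all_algebra.
From mathcomp Require Import all_classical all_reals exp.
From mathcomp Require Import complex.
Import Order.TTheory GRing.Theory Num.Theory.

Set Implicit Arguments.
Unset Strict Implicit.
Unset Printing Implicit Defensive.

Local Open Scope ring_scope.
Local Open Scope classical_set_scope.

(* real numbers viewed as complex numbers *)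
Definition Cof {R : realType} (x : R) : R[i] := (x%:C)%C.

(* real part and modulus of a complex number, as real numbers *)
Definition ReC {R : realType} (z : R[i]) : R := complex.Re z.
Definition absC {R : realType} (z : R[i]) : R := Normc.normc z.

(* x is an algebraic integer: root of a monic polynomial with integer coefficients *)
Definition is_alg_int {F : comNzRingType} (x : F) : Prop :=
  exists q : {poly int}, q \is monic /\ root (map_poly (fun z : int => z%:~R) q) x.

(* evaluation of a rational polynomial *)
Definition evR {R : realType} (p : {poly rat}) (x : R) : R := (map_poly ratr p).[x].
Definition evC {R : realType} (p : {poly rat}) (z : R[i]) : R[i] := (map_poly ratr p).[z].

(* P is the minimal polynomial of lam over Q *)
Definition is_minpoly {R : realType} (P : {poly rat}) (lam : R) : Prop :=
  [/\ P \is monic, irreducible_poly P & root (map_poly ratr P) lam].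

(* Galois conjugates of lam = complex roots of its minimal polynomial P *)
Definition is_conj {R : realType} (P : {poly rat}) (z : R[i]) : Prop :=
  root (map_poly ratr P) z.

(* lam (with minimal polynomial P) is a Perron number *)
Definition is_Perron {R : realType} (P : {poly rat}) (lam : R) : Prop :=
  [/\ 1 <= lam, is_alg_int lam &
      forall z : R[i], is_conj P z -> z != Cof lam -> absC z < lam].

(* rho is the spectral ratio of lam: max over conjugates z <> lam of |z|/lam *)
Definition is_spectral_ratio {R : realType} (P : {poly rat}) (lam rho : R) : Prop :=
  (exists2 z : R[i], is_conj P z & z != Cof lam /\ absC z / lam = rho) /\
  (forall z : R[i], is_conj P z -> z != Cof lam -> absC z / lam <= rho).

(* e : 'I_d -> C enumerates the d complex embeddings of K = Q(lam):
   sigma_k (p.[lam]) = p.[e k] *)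
Definition is_embedding_enum {R : realType} (P : {poly rat}) (d : nat)
  (e : 'I_d -> R[i]) : Prop :=
  injective e /\ forall k, is_conj P (e k).

(* w : 'I_d -> Q[X] represents a Z-basis (w j).[lam] of O_K *)
Definition is_Zbasis {R : realType} (lam : R) (d : nat) (w : 'I_d -> {poly rat}) : Prop :=
  (forall j, is_alg_int (evR (w j) lam)) /\
  (forall p : {poly rat}, is_alg_int (evR p lam) ->
     exists! c : 'I_d -> int, evR p lam = \sum_(j < d) (c j)%:~R * evR (w j) lam).

(* discriminant D_K = det(sigma_i(w_j))^2 *)
Definition discK {R : realType} (d : nat) (e : 'I_d -> R[i]) (w : 'I_d -> {poly rat}) : R[i] :=
  (\det (\matrix_(i < d, j < d) evC (w j) (e i))) ^+ 2.

(* K_R realised inside C^d via all embeddings: vectors x with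
   x_j = conj(x_i) whenever sigma_j = conj(sigma_i) *)
Definition KR {R : realType} (d : nat) (e : 'I_d -> R[i]) : set ('I_d -> R[i]) :=
  [set x | forall i j, e j = (e i)^* -> x j = (x i)^*].

(* O_K inside K_R *)
Definition OK_emb {R : realType} (lam : R) (d : nat) (e : 'I_d -> R[i]) : set ('I_d -> R[i]) :=
  [set v | exists p : {poly rat}, is_alg_int (evR p lam) /\ v = (fun k => evC p (e k))].

(* the set frak B of admissible weights alpha *)
Definition Bset {R : realType} (d : nat) (e : 'I_d -> R[i]) : set ('I_d -> R) :=
  [set a | (forall i, 0 < a i) /\ (forall i j, e j = (e i)^* -> a j = a i)].

(* q_alpha(x, y) = Trace(alpha x ybar) *)
Definition qform {R : realType} (d : nat) (a : 'I_d -> R) (x y : 'I_d -> R[i]) : R :=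
  ReC (\sum_(k < d) Cof (a k) * x k * (y k)^*).

(* max(O_K, q_alpha) *)
Definition maxOK {R : realType} (lam : R) (d : nat) (e : 'I_d -> R[i]) (a : 'I_d -> R) : R :=
  inf [set u : R | forall x, KR e x ->
         exists2 y, OK_emb lam e y & qform a (fun k => x k - y k) (fun k => x k - y k) <= u].

(* det(O_K, q_alpha) computed with the Z-basis w *)
Definition detOK {R : realType} (d : nat) (e : 'I_d -> R[i]) (w : 'I_d -> {poly rat})
  (a : 'I_d -> R) : R :=
  \det (\matrix_(i < d, j < d)
          qform a (fun k => evC (w i) (e k)) (fun k => evC (w j) (e k))).

Definition thickness {R : realType} (lam : R) (d : nat) (e : 'I_d -> R[i])
  (w : 'I_d -> {poly rat}) (a : 'I_d -> R) : R :=
  maxOK lam e a / (detOK e w a) `^ (d%:R^-1).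

Definition tau_min {R : realType} (lam : R) (d : nat) (e : 'I_d -> R[i])
  (w : 'I_d -> {poly rat}) : R :=
  inf [set t : R | exists2 a, Bset e a & t = thickness lam e w a].

(* non-negative real square matrix irreducibility *)
Definition irreducible_mx {R : realType} (n : nat) (A : 'M[R]_n) : Prop :=
  forall i j : 'I_n, exists k : nat, 0 < (A ^+ k) i j.

(* spectral radius of a real square matrix: max modulus of complex eigenvalues *)
Definition is_spectral_radius {R : realType} (n : nat) (A : 'M[R]_n) (r : R) : Prop :=
  (exists2 z : R[i], root (char_poly (map_mx Cof A)) z & absC z = r) /\
  (forall z : R[i], root (char_poly (map_mx Cof A)) z -> absC z <= r).

(* d_PF^irr(lam) <= b : there is an n x n non-negative integral irreducible
   matrix with spectral radius lam and n <= b *)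
Definition dPFirr_le {R : realType} (lam b : R) : Prop :=
  exists (n : nat) (A : 'M[int]_n),
    [/\ forall i j, 0 <= A i j,
        irreducible_mx (map_mx (fun z : int => z%:~R : R) A),
        is_spectral_radius (map_mx (fun z : int => z%:~R : R) A) lam &
        n%:R <= b].

(* Main.v *)
Require Import Defs.
From HB Require Import structures.
From mathcomp Require Import all_boot all_order all_algebra.
From mathcomp Require Import all_classical all_reals exp.
From mathcomp Require Import complex perm.
From mathcomp Require Import zify ring lra.
Import Order.TTheory GRing.Theory Num.Theory.

Set Implicit Arguments.
Unset Strict Implicit.
Unset Printing Implicit Defensive.

Local Open Scope ring_scope.

(* Let Z be the set of algebraic integers of K that lie in the cone where every
   conjugate x_k satisfies |x_k| / r_k <= x_0 / r_0, with 0 < x_0 / r_0 <= H.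
   Here x_0 is the coordinate of the identity embedding and the radii r_k are such
   that every point of K_R is coordinatewise within r_k of O_K. Multiplication by
   lam contracts the cone by the factor rho, so for H = 10 / (1 - rho) the product
   of lam with a point of Z can be cut into pieces that, after moving the cut points
   to O_K, again lie in Z. The coefficients of these decompositions form a
   non-negative integral matrix with the positive eigenvector (x_0), x in Z, for the
   eigenvalue lam, and an irreducible block of it has spectral radius lam. Counting
   the elements of Z modulo a sublattice gives
     |Z| <= (33 d^2 / (1 - rho))^d * (prod_k r_k) / sqrt |D_K|.
   For the first bound, r_k = sqrt (u / alpha_k) with u slightly above
   max(O_K, q_alpha). For the second, a nonzero element y of the trace dual of O_K
   has norm at least 1 / |D_K|, so a transference argument bounds the covering
   radius of O_K by 2^d |D_K|^(1/d), which is used for all r_k. *)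

(** * Moduli and the reduction to finite sets of positive reals *)

Section ComplexModulus.
Variable R : realType.
Implicit Types (x : R) (z u : R[i]).

Lemma absCE z : Cof (absC z) = `|z|. Proof. by []. Qed.

Lemma absC_ge0 z : 0 <= absC z.
Proof. by have := normr_ge0 z; rewrite -absCE /Cof ler0c. Qed.

Lemma absCM z u : absC (z * u) = absC z * absC u.
Proof. exact: Normc.normcM. Qed.

Lemma absCD z u : absC (z + u) <= absC z + absC u.
Proof. exact: le_normcD. Qed.

Lemma absCN z : absC (- z) = absC z.
Proof. exact: normcN. Qed.

Lemma absCB z u : absC (z - u) <= absC z + absC u.
Proof. by rewrite (le_trans (absCD _ _)) // absCN. Qed.

Lemma absC_dist z u : absC (z - u) = absC (u - z).
Proof. by rewrite -absCN opprB. Qed.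

Lemma absC0 : absC (0 : R[i]) = 0.
Proof. exact: Normc.normc0. Qed.

Lemma absC_eq0 z : (absC z == 0) = (z == 0).
Proof.
by apply/eqP/eqP => [|->]; [exact: Normc.eq0_normc | exact: absC0].
Qed.

Lemma absC_Cof x : absC (Cof x) = `|x|.
Proof. by rewrite /absC /= expr0n addr0 sqrtr_sqr. Qed.

Lemma absC_ge0_Cof x : 0 <= x -> absC (Cof x) = x.
Proof. by move=> x0; rewrite absC_Cof ger0_norm. Qed.

Lemma absC_conj z : absC z^* = absC z.
Proof. by apply: complexI; rewrite -!/(Cof _) !absCE norm_conjC. Qed.

Lemma absC_sum (I : Type) (r : seq I) (P : pred I) (F : I -> R[i]) :
  absC (\sum_(i <- r | P i) F i) <= \sum_(i <- r | P i) absC (F i).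
Proof.
apply: (big_rec2 (fun u v => absC u <= v)); first by rewrite absC0.
by move=> i u v _ le_uv; rewrite (le_trans (absCD _ _)) ?lerD2l.
Qed.

Lemma absC_prod (I : Type) (r : seq I) (P : pred I) (F : I -> R[i]) :
  absC (\prod_(i <- r | P i) F i) = \prod_(i <- r | P i) absC (F i).
Proof.
apply: (big_morph _ absCM); by rewrite /absC Normc.normc1.
Qed.

Lemma absC_exp z n : absC (z ^+ n) = absC z ^+ n.
Proof.
elim: n => [|n IH]; first by rewrite /absC Normc.normc1.
by rewrite !exprS absCM IH.
Qed.

Lemma absC_int (m : int) : absC (m%:~R : R[i]) = `|m%:~R|.
Proof.
by rewrite -absC_Cof /Cof; congr absC; rewrite rmorph_int.
Qed.

Lemma ReC_le z : `|ReC z| <= absC z.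
Proof.
by rewrite -lecR -[in leRHS]/(Cof _) absCE; exact: normc_ge_Re.
Qed.

Lemma absC_sqr z : absC z ^+ 2 = ReC z ^+ 2 + complex.Im z ^+ 2.
Proof.
by case: z => a b; rewrite /absC /= sqr_sqrtr // addr_ge0 ?sqr_ge0.
Qed.

Lemma ReC_sum (I : Type) (r : seq I) (P : pred I) (F : I -> R[i]) :
  ReC (\sum_(i <- r | P i) F i) = \sum_(i <- r | P i) ReC (F i).
Proof. by apply: (big_morph (@ReC R)) => // -[a b] [a' b']. Qed.

Lemma ImC_sum (I : Type) (r : seq I) (P : pred I) (F : I -> R[i]) :
  complex.Im (\sum_(i <- r | P i) F i) = \sum_(i <- r | P i) complex.Im (F i).
Proof. by apply: (big_morph (@complex.Im R)) => // -[a b] [a' b']. Qed.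

End ComplexModulus.

Lemma char_poly_tr (F : comNzRingType) n (A : 'M[F]_n) :
  char_poly A^T = char_poly A.
Proof.
rewrite /char_poly -det_tr; congr (\det _).
by apply/matrixP => i j; rewrite !mxE eq_sym.
Qed.

(** [v] is a right eigenvector, so the transpose exhibits the eigenvalue [lam]. For an arbitrary
    eigenvalue z with left eigenvector u, pairing |u| with [v] gives |z| S <= lam S, where S = sum_i
    |u_i| v_i > 0. *)
Lemma spectral_radius_pos_eigenvector (R : realType) n (A : 'M[R]_n)
    (v : 'I_n -> R) (lam : R) :
  (0 < n)%N -> (forall i j, 0 <= A i j) -> (forall i, 0 < v i) -> 0 <= lam ->
  (forall i, \sum_j A i j * v j = lam * v i) -> is_spectral_radius A lam.
Proof.
move=> n0 A0 v0 lam0 Av; split.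
  exists (Cof lam); last exact: absC_ge0_Cof.
  rewrite -char_poly_tr -eigenvalue_root_char; apply/eigenvalueP.
  exists (\row_j Cof (v j)); last first.
    apply/eqP => /rowP/(_ (Ordinal n0)); rewrite !mxE => -[] e0.
    by have := v0 (Ordinal n0); rewrite e0 ltxx.
  apply/rowP => i; rewrite !mxE /Cof -rmorphM -Av rmorph_sum /=.
  by apply: eq_bigr => j _; rewrite !mxE rmorphM mulrC.
move=> z; rewrite -eigenvalue_root_char => /eigenvalueP[u uA u0].
pose S := \sum_i absC (u 0 i) * v i.
have S0 : 0 < S.
  have [i ui] : exists i, u 0 i != 0.
    by apply/rV0Pn.
  rewrite /S (bigD1 i) //= ltr_pwDl //.
    by rewrite mulr_gt0 // lt_def absC_eq0 ui absC_ge0.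
  by apply: sumr_ge0 => j _; rewrite mulr_ge0 ?absC_ge0 // ltW.
rewrite -(ler_pM2r S0).
have -> : lam * S = \sum_j (\sum_i absC (u 0 i) * A i j) * v j.
  under eq_bigr do rewrite mulr_suml.
  rewrite exchange_big mulr_sumr; apply: eq_bigr => i _ /=.
  by under eq_bigr do rewrite -mulrA; rewrite -mulr_sumr Av; ring.
rewrite /S mulr_sumr; apply: ler_sum => j _; rewrite mulrA.
rewrite ler_wpM2r ?(ltW (v0 j)) // -absCM.
move/rowP/(_ j): uA; rewrite !mxE => <-.
apply: (le_trans (absC_sum _ _ _)); apply: ler_sum => i _.
by rewrite absCM mxE absC_ge0_Cof.
Qed.

Lemma sum_count_mem (R : realType) (s t : seq R) : uniq s -> {subset t <= s} ->
  \sum_(x <- s) (count_mem x t)%:R * x = \sum_(y <- t) y.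
Proof.
move=> us; elim: t => [|y t IH] sub.
  by rewrite big_nil big1 // => x _; rewrite mul0r.
rewrite big_cons -IH; last by move=> x xt; apply: sub; rewrite inE xt orbT.
have ys : y \in s by apply: sub; rewrite inE eqxx.
rewrite (eq_bigr (fun x => (y == x)%:R * x + (count_mem x t)%:R * x)); last first.
  by move=> x _; rewrite -mulrDl -natrD.
rewrite big_split /= (bigD1_seq y) //= eqxx mul1r big1 ?addr0 // => x.
by rewrite eq_sym => /negPf ->; rewrite mul0r.
Qed.

(* A matrix of minimal size is irreducible: otherwise the indices reachable from
   some index span a smaller one. *)
Lemma dPFirr_le_of_positive_seq (R : realType) (lam : R) (s : seq R) :
  0 <= lam -> (0 < size s)%N -> (forall x, x \in s -> 0 < x) ->
  (forall x, x \in s -> exists2 t, {subset t <= s} & lam * x = \sum_(y <- t) y) ->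
  dPFirr_le lam (size s)%:R.
Proof.
move=> lam0; have [n] := ubnP (size s); elim: n s => // n IH s.
rewrite ltnS => sz s0 pos dec.
have [|us] := boolP (uniq s); last first.
  have lt : (size (undup s) < size s)%N by rewrite ltn_size_undup.
  have [|||m [A [? ? ? le_m]]] := IH (undup s) (leq_trans lt sz).
  - by rewrite lt0n size_eq0; apply/eqP => /undup_nil es; rewrite es in s0.
  - by move=> x; rewrite mem_undup => /pos.
  - move=> x; rewrite mem_undup => /dec[t st tE]; exists t => // y /st.
    by rewrite mem_undup.
  exists m, A; split=> //; rewrite (le_trans le_m) // ler_nat ltnW //.
move=> us; pose N := size s.
have mem_s (i : 'I_N) : s`_i \in s by apply: mem_nth.
have /choice[t tP] (i : 'I_N) :
    exists u, {subset u <= s} /\ lam * s`_i = \sum_(y <- u) y.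
  by have [u ? ?] := dec _ (mem_s i); exists u.
(* Row i records the multiplicities in the decomposition of lam * s_i, which makes the entries of
   [s] a positive eigenvector. *)
pose A : 'M[int]_N := \matrix_(i, j) (count_mem s`_j (t i))%:Z.
pose B : 'M[R]_N := map_mx (fun z : int => z%:~R : R) A.
have B0 i j : 0 <= B i j by rewrite !mxE.
have Bv i : \sum_j B i j * s`_j = lam * s`_i.
  have [sub ->] := tP i; rewrite -(sum_count_mem us sub) (big_nth 0) big_mkord.
  by apply: eq_bigr => j _; rewrite !mxE.
have Bk0 k i j : 0 <= (B ^+ k) i j.
  elim: k i j => [|k IHk] i j; first by rewrite expr0 !mxE ler0n.
  by rewrite exprS mxE sumr_ge0 // => l _; rewrite mulr_ge0.
have [irr|] := pselect (irreducible_mx B).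
  exists N, A; split=> //; first by move=> i j; rewrite mxE.
  by apply: (spectral_radius_pos_eigenvector _ B0 _ lam0 Bv) => // i; apply: pos.
move=> /existsNP[i0] /existsNP[j0] /forallNP noPath.
pose reach (x : R) := `[< exists2 j : 'I_N, x = s`_j & exists k : nat, 0 < (B ^+ k) i0 j >].
pose s' := [seq x <- s | reach x].
have s'i0 : s`_i0 \in s'.
  rewrite mem_filter mem_s andbT; apply/asboolP; exists i0 => //; exists 0%N.
  by rewrite expr0 mxE eqxx ltr01.
have lt : (size s' < size s)%N.
  rewrite ltn_neqAle size_filter count_size andbT -all_count.
  apply/negP => /allP/(_ _ (mem_s j0))/asboolP[j /eqP].
  by rewrite nth_uniq // => /eqP/val_inj <- [k /noPath].
have [||| m [A' [? ? ? le_m]]] := IH s' (leq_trans lt sz).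
- by case: (s') s'i0.
- by move=> x; rewrite mem_filter => /andP[_ /pos].
- move=> x; rewrite mem_filter => /andP[/asboolP[j -> [k kP]] _].
  have [sub tE] := tP j; exists (t j) => // y yt.
  have ys := sub _ yt; rewrite mem_filter ys andbT; apply/asboolP.
  have ly : (index y s < N)%N by rewrite index_mem.
  exists (Ordinal ly); first by rewrite /= nth_index.
  exists k.+1; rewrite exprSr mxE (bigD1 j) //= ltr_pwDl //; last first.
    by apply: sumr_ge0 => l _; rewrite mulr_ge0.
  rewrite mulr_gt0 // !mxE /= nth_index // ltr0z.
  by rewrite ltz_nat -has_count has_pred1.
by exists m, A'; split=> //; rewrite (le_trans le_m) // ler_nat ltnW.
Qed.

(** * Covering radius against the dual minimum *)

Section DotProduct.
Variables (R : realType) (n : nat).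
Implicit Types u v : 'rV[R]_n.

Definition dotv u v : R := (u *m v^T) 0 0.

Lemma mulmx_tr_dotv u v : u *m v^T = (dotv u v)%:M.
Proof. exact: mx11_scalar. Qed.

Lemma dotvE u v : dotv u v = \sum_i u 0 i * v 0 i.
Proof. by rewrite /dotv mxE; apply: eq_bigr => i _; rewrite mxE. Qed.

Lemma dotvC u v : dotv u v = dotv v u.
Proof. by rewrite !dotvE; apply: eq_bigr => i _; rewrite mulrC. Qed.

Lemma dotvDl u1 u2 v : dotv (u1 + u2) v = dotv u1 v + dotv u2 v.
Proof. by rewrite /dotv mulmxDl mxE. Qed.

Lemma dotvZl a u v : dotv (a *: u) v = a * dotv u v.
Proof. by rewrite /dotv -scalemxAl mxE. Qed.

Lemma dotvDr u v1 v2 : dotv u (v1 + v2) = dotv u v1 + dotv u v2.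
Proof. by rewrite dotvC dotvDl !(dotvC u). Qed.

Lemma dotvZr a u v : dotv u (a *: v) = a * dotv u v.
Proof. by rewrite dotvC dotvZl dotvC. Qed.

Lemma dotvv_ge0 u : 0 <= dotv u u.
Proof. by rewrite dotvE sumr_ge0 // => i _; rewrite -expr2 sqr_ge0. Qed.

Lemma dotvv_pythagoras u v a : dotv u v = 0 ->
  dotv (u + a *: v) (u + a *: v) = dotv u u + a ^+ 2 * dotv v v.
Proof.
by move=> uv; rewrite !(dotvDl, dotvDr, dotvZl, dotvZr) (dotvC v) uv; ring.
Qed.

End DotProduct.

Notation intmx R := (map_mx (fun z : int => z%:~R : R)).

Section IntMatrix.
Variable F : comNzRingType.

Lemma intmxM m n p (A : 'M[int]_(m, n)) (B : 'M[int]_(n, p)) :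
  intmx F (A *m B) = intmx F A *m intmx F B.
Proof. exact: (map_mxM (intmul 1 : {rmorphism int -> F})). Qed.

Lemma intmx1 n : intmx F (1%:M : 'M[int]_n) = 1%:M.
Proof. exact: (map_mx1 (intmul 1 : {rmorphism int -> F})). Qed.

Lemma intmxVK n p (A : 'M[int]_n) (B : 'M[F]_(n, p)) : A \in unitmx ->
  intmx F (invmx A) *m (intmx F A *m B) = B.
Proof. by move=> uA; rewrite mulmxA -intmxM mulVmx // intmx1 mul1mx. Qed.

End IntMatrix.

(** The Smith normal form of a single row has one invariant factor, which up to sign is the content
    [k]. *)
Lemma primitive_basis n (m : 'rV[int]_n.+1) : m != 0 ->
  exists (k : int) (U : 'M[int]_n.+1), [/\ k != 0, U \in unitmx & m = k *: row 0 U].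
Proof.
move=> m0; have [L uL [U uU [s _ mE]]] := int_Smith_normal_form m.
exists (L 0 0 * s`_0), U; have mE' : m = (L 0 0 * s`_0) *: row 0 U.
  rewrite mE; apply/rowP => j; rewrite !mxE (bigD1 ord0) //= big1 ?addr0.
    by rewrite !mxE big_ord1 !mxE /= mulr1n.
  move=> i i0; rewrite !mxE big_ord1 !mxE eq_sym.
  by rewrite (_ : (i == 0 :> nat) = false) ?mulr0 ?mul0r //; apply/negbTE.
split=> //; apply: contraNneq m0 => k0.
by rewrite mE' k0 scale0r.
Qed.

Section Transference.
Variable R : realType.

Definition lattice_min_ge d n (Y : 'M[R]_(d, n)) (s : R) : Prop :=
  forall m : 'rV[int]_d, m != 0 ->
    s <= dotv (intmx R m *m Y) (intmx R m *m Y).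

(** When the rows of [Y] are a lattice basis, this says that the dual lattice has squared covering
    radius at most [b]. In this form no dual basis has to be carried through the projections. *)
Definition solves_mod1 d n (Y : 'M[R]_(d, n)) (b : R) : Prop :=
  forall c : 'cV[R]_d, exists (x : 'rV[R]_n) (z : 'cV[int]_d),
    dotv x x <= b /\ Y *m x^T = c + intmx R z.

Lemma solves_mod1_unimodular d n (Y : 'M[R]_(d, n)) (U : 'M[int]_d) b :
  U \in unitmx -> solves_mod1 (intmx R U *m Y) b -> solves_mod1 Y b.
Proof.
move=> uU sol c; have [x [z [xb E]]] := sol (intmx R U *m c).
exists x, (invmx U *m z); split=> //.
by rewrite -(intmxVK (Y *m _) uU) (mulmxA (intmx R U)) E mulmxDr intmxVK // intmxM.
Qed.

(** A vector within a factor 2 of the infimum suffices, so attainment of the minimum is not an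
    issue. Dividing it by its content only shortens it and makes it the first row of a unimodular
    matrix. *)
Lemma lattice_near_min d n (Y : 'M[R]_(d.+1, n)) s : 0 < s ->
  lattice_min_ge Y s -> exists U : 'M[int]_d.+1, U \in unitmx /\
    forall m : 'rV[int]_d.+1, m != 0 ->
      dotv (row 0 (intmx R U) *m Y) (row 0 (intmx R U) *m Y) <=
      2 * dotv (intmx R m *m Y) (intmx R m *m Y).
Proof.
move=> s0 Ys; pose N (m : 'rV[int]_d.+1) := dotv (intmx R m *m Y) (intmx R m *m Y).
pose A : set R := [set N m | m in [set m | m != 0]]%classic.
have infA : has_inf A.
  split; last by exists s => _ [m /= /Ys ? <-].
  exists (N (delta_mx 0 0)), (delta_mx 0 0) => //=.
  by apply/eqP => /rowP/(_ 0); rewrite !mxE !eqxx.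
have sA : s <= inf A by apply: lb_le_inf => [|_ [m /= /Ys ? <-]//]; case: infA.
have [_ [m /= m0 <-] mlt] : exists2 x, A x & x < inf A + inf A.
  have e0 : 0 < inf A by rewrite (lt_le_trans s0).
  exact: inf_adherent.
have [k [U [k0 uU mE]]] := primitive_basis m0.
exists U; split=> // m' m'0.
have : inf A <= N m' by apply: ge_inf; [case: infA | exists m'].
suff : dotv (row 0 (intmx R U) *m Y) (row 0 (intmx R U) *m Y) <= N m.
  by move: mlt; rewrite /N; lra.
set v := row 0 _ *m Y.
have -> : N m = k%:~R ^+ 2 * dotv v v.
  have E : intmx R m *m Y = k%:~R *: v.
    rewrite mE /v scalemxAl; congr (_ *m _); apply/rowP => j.
    by rewrite !mxE rmorphM.
  by rewrite /N E dotvZl dotvZr; ring.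
rewrite ler_peMl ?dotvv_ge0 // -rmorphXn /= ler1z -gtz0_ge1.
by rewrite lt_def sqr_ge0 andbT sqrf_eq0.
Qed.

(* Induction on the rank: split off a nearly shortest primitive vector b. The
   projections of the other rows orthogonally to b still have squared minimum
   at least s / 4, since the b-component of a lift can be reduced to at most
   b / 2. *)
Lemma solves_mod1_transference d n (Y : 'M[R]_(d, n)) s : 0 < s ->
  lattice_min_ge Y s -> solves_mod1 Y ((4 ^+ d - 1) / s).
Proof.
elim: d Y s => [|d IH] Y s s0 Ys.
  move=> c; exists 0, 0; rewrite expr0 subrr mul0r dotvE big1.
    by split=> //; apply/matrixP => -[].
  by move=> i _; rewrite mxE mul0r.
have [U [uU]] := lattice_near_min s0 Ys; rewrite -row_mul.
have {}Ys : lattice_min_ge (intmx R U *m Y) s.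
  move=> m m0; rewrite mulmxA -intmxM; apply: Ys.
  by apply: contra_neq m0 => mU; rewrite -[m](mulmxK uU) mU mul0mx.
move=> near; apply: (solves_mod1_unimodular uU); move: Ys.
have {}near : forall m : 'rV[int]_d.+1, m != 0 ->
    dotv (row 0 (intmx R U *m Y)) (row 0 (intmx R U *m Y)) <=
    2 * dotv (intmx R m *m (intmx R U *m Y)) (intmx R m *m (intmx R U *m Y)).
  move=> m m0; rewrite mulmxA -intmxM; apply: near.
  by apply: contra_neq m0 => mU; rewrite -[m](mulmxK uU) mU mul0mx.
move: (intmx R U *m Y) near => {U uU}; rewrite -[d.+1]/(1 + d)%N => {}Y near Ys.
pose b := usubmx Y; pose Y1 := dsubmx Y; pose N := dotv b b.
have YE : Y = col_mx b Y1 by rewrite vsubmxK.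
have rowY : row 0 Y = b.
  by apply/rowP => j; rewrite !mxE; congr (Y _ _); apply: val_inj.
have Ns : s <= N.
  have m0 : row_mx (1%:M : 'M[int]_1) (0 : 'rV[int]_d) != 0.
    by apply/eqP => /rowP/(_ 0); rewrite mxE; case: splitP => // j; rewrite !mxE !ord1 eqxx.
  have := Ys _ m0; rewrite map_row_mx intmx1 map_mx0 YE mul_row_col mul1mx.
  by rewrite mul0mx addr0.
have N0 : 0 < N by apply: lt_le_trans Ns.
pose mu : 'cV[R]_d := N^-1 *: (Y1 *m b^T).
pose Y' := Y1 - mu *m b.
have Y'b : Y' *m b^T = 0.
  rewrite mulmxBl -mulmxA mulmx_tr_dotv mul_mx_scalar scalerA mulfV ?gt_eqF //.
  by rewrite scale1r subrr.
have Y's : lattice_min_ge Y' (s / 4).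
  move=> m m0; pose q := (intmx R m *m mu) 0 0.
  have qE : intmx R m *m mu = q%:M by apply: mx11_scalar.
  pose k := Num.floor (q + 1 / 2).
  have /andP[k1 k2] : (k%:~R <= q + 1 / 2 < (k + 1)%:~R) by rewrite floor_le floorD1_gt.
  pose m' := row_mx (- k)%:M m.
  have m'0 : m' != 0.
    by apply: contra_neq m0 => e0; rewrite -[m](row_mxKr (- k)%:M) -/m' e0 linear0.
  have := near _ m'0; have -> : intmx R m' *m Y = intmx R m *m Y' + (q - k%:~R) *: b.
    rewrite YE map_row_mx mul_row_col mulmxBr mulmxA qE mul_scalar_mx.
    rewrite map_scalar_mx /= mul_scalar_mx rmorphN scaleNr scalerBl.
    by rewrite addrA subrK addrC.
  (* Near-minimality of [b] reads N <= 2 (D + a N), with D the squared norm of the projection and a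
     = (q - k)^2 <= 1/4. Hence D >= N / 4 >= s / 4. *)
  rewrite rowY -/N dotvv_pythagoras; last first.
    by rewrite /dotv -mulmxA Y'b mulmx0 mxE.
  rewrite -/N.
  have : (q - k%:~R) ^+ 2 <= 1 / 4.
    by move: k2; rewrite rmorphD /= => k2; nra.
  set D := dotv _ _; set a := (q - _) ^+ 2 => a4 le2.
  have : a * N <= 1 / 4 * N by rewrite ler_pM2r.
  by lra.
move=> c; have s4 : 0 < s / 4 by lra.
pose f := c 0 0 - (Num.floor (c 0 0))%:~R.
have /andP[f0 f1] : 0 <= f < 1.
  rewrite /f subr_ge0 ltrBlDr addrC floor_le /=.
  by have := floorD1_gt (c 0 0); rewrite rmorphD.
(* Since [Y1 = Y' + mu *m b] and the final [x] has product [f] with [b], the term [f *: mu] is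
   subtracted in advance. Replacing the [b]-component of [x'] by [(f / N) *: b] costs at most 1 / s,
   and 4 (4^d - 1) + 1 <= 4^(d+1) - 1. *)
have [x' [z' [x'b x'E]]] := IH _ _ s4 Y's (dsubmx c - f *: mu).
pose a := dotv x' b / N.
pose x'' := x' - a *: b; pose x := x'' + (f / N) *: b.
have x''b : dotv x'' b = 0.
  by rewrite /x'' -scaleNr dotvDl dotvZl -/N mulNr divfK ?subrr ?gt_eqF.
exists x, (col_mx (- Num.floor (c 0 0))%:M z'); split.
  rewrite dotvv_pythagoras // -/N.
  have x''x' : dotv x'' x'' <= dotv x' x'.
    have -> : x' = x'' + a *: b by rewrite subrK.
    by rewrite dotvv_pythagoras // lerDl mulr_ge0 ?sqr_ge0 // ltW.
  apply: le_trans (_ : dotv x' x' + s^-1 <= _).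
    apply: lerD => //; rewrite expr_div_n expr2 (expr2 N).
    have -> : f * f / (N * N) * N = f * f / N by field; rewrite gt_eqF.
    rewrite ler_pdivrMr //; apply: (@le_trans _ _ 1); first by nra.
    by rewrite mulrC ler_pdivlMr // mul1r.
  have : dotv x' x' <= 4 * (4 ^+ d - 1) / s.
    by apply: le_trans x'b _; rewrite invf_div mulrCA mulrA.
  have : 0 < s^-1 by rewrite invr_gt0.
  by rewrite exprS; lra.
have bx : b *m x^T = f%:M.
  rewrite mulmx_tr_dotv dotvC dotvDl x''b add0r dotvZl -/N divfK //.
  by rewrite gt_eqF.
have Y'x : Y' *m x^T = dsubmx c - f *: mu + intmx R z'.
  rewrite -x'E /x /x'' !linearD /= !linearN /= !linearZ /=.
  by rewrite Y'b !(scaler0, oppr0, addr0).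
have Y1x : Y1 *m x^T = dsubmx c + intmx R z'.
  have -> : Y1 = Y' + mu *m b by rewrite subrK.
  by rewrite mulmxDl -mulmxA bx Y'x mul_mx_scalar addrAC subrK.
have cE : c = col_mx (c 0 0)%:M (dsubmx c).
  rewrite -[LHS]vsubmxK; congr col_mx; apply/matrixP => i j.
  by rewrite !ord1 !mxE mulr1n; congr (c _ _); apply: val_inj.
rewrite YE mul_col_mx bx Y1x map_col_mx [X in _ = X + _]cE add_col_mx.
congr col_mx; apply/matrixP => i j.
by rewrite !ord1 !mxE !mulr1n /= rmorphN.
Qed.

End Transference.

(** * Counting lattice points in a box *)

Lemma card_family_lt n (c : 'I_n -> nat) B : (forall i, c i <= B.+1)%N ->
  #|family (fun i : 'I_n => [pred k : 'I_B.+1 | (k < c i)%N])| = (\prod_i c i)%N.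
Proof.
move=> cB; rewrite card_family foldrE big_map big_enum /=.
apply: eq_bigr => i _; rewrite -[RHS](card_ord (c i)).
have inj : injective (widen_ord (cB i)) by move=> j k /(congr1 val) /= /val_inj.
rewrite -(card_imset _ inj).
apply: eq_card => k; apply/idP/imsetP => [kc|[j _ ->]]; last exact: (ltn_ord j).
by exists (Ordinal kc) => //; apply: val_inj.
Qed.

(** Let M = L D U be the Smith normal form. The class of x modulo the row lattice of M is determined
    by the residues of the coordinates of x U^-1 modulo the diagonal of D, which leave |det M|
    possibilities. *)
Lemma size_incongruent n (M : 'M[int]_n) (s : seq 'rV[int]_n) :
  \det M != 0 -> uniq s ->
  (forall x y z, x \in s -> y \in s -> x - y = z *m M -> x = y) ->
  (size s <= `|\det M|)%N.
Proof.
move=> M0 us inc; have [L uL [U uU [ds _ ME]]] := int_Smith_normal_form M.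
pose D : 'M[int]_n := \matrix_(i, j) (ds`_i *+ (i == j :> nat)).
have DE : D = diag_mx (\row_i ds`_i).
  by apply/matrixP => i j; rewrite !mxE.
have unit1 (V : 'M[int]_n) : V \in unitmx -> `|\det V|%N = 1%N.
  by rewrite unitmxE qualifE /= => /orP[] /eqP ->.
have detM : `|\det M|%N = (\prod_(i < n) absz (ds`_i)%R)%N.
  rewrite ME !det_mulmx !abszM (unit1 _ uL) (unit1 _ uU) mul1n muln1 -/D DE det_diag.
  rewrite (big_morph absz abszM (erefl : absz 1 = 1%N)).
  by apply: eq_bigr => i _; rewrite mxE.
have d0 (i : 'I_n) : ds`_i != 0.
  have : `|\det M|%N != 0%N by rewrite absz_eq0.
  by rewrite detM (bigD1 i) //= muln_eq0 negb_or absz_eq0 => /andP[].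
pose B := (\sum_(i < n) absz (ds`_i)%R)%N.
have dB (i : 'I_n) : (absz (ds`_i)%R <= B.+1)%N.
  by rewrite /B (bigD1 i) //= leqW // leq_addr.
pose phi (x : 'rV[int]_n) : {ffun 'I_n -> 'I_B.+1} :=
  [ffun i => inord (absz ((x *m invmx U)%R ord0 i %% (ds`_i)%R)%Z)].
have phi_lt (x : 'rV[int]_n) (i : 'I_n) : (absz ((x *m invmx U)%R ord0 i %% (ds`_i)%R)%Z < absz (ds`_i)%R)%N.
  have := ltz_mod ((x *m invmx U) ord0 i) (d0 i).
  have := modz_ge0 ((x *m invmx U) ord0 i) (d0 i).
  set m := modz _ _; lia.
have phiE x i : phi x i = absz ((x *m invmx U)%R ord0 i %% (ds`_i)%R)%Z :> nat.
  by rewrite ffunE inordK // (leq_trans (phi_lt x i)).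
rewrite detM -(card_family_lt dB) -(size_map phi) cardE.
apply: uniq_leq_size => [|_ /mapP[x xs ->]]; last first.
  rewrite mem_enum; apply/familyP => i; rewrite inE /=.
  by have := phi_lt x i; rewrite -phiE.
rewrite map_inj_in_uniq // => x y xs ys exy.
pose q : 'rV[int]_n := \row_i (((x - y) *m invmx U) ord0 i %/ ds`_i)%Z.
apply: (inc x y (q *m invmx L)) => //.
rewrite ME !mulmxA (mulmxKV uL) -/D.
rewrite -[LHS](mulmxKV uU); congr (_ *m _); apply/rowP => i.
rewrite DE mul_mx_diag !mxE.
have : (ds`_i %| ((x - y) *m invmx U) ord0 i)%Z.
  rewrite mulmxBl !mxE -eqz_mod_dvd; apply/eqP.
  have : phi x i = phi y i :> nat by rewrite exy.
  rewrite !phiE !mxE => /(congr1 Posz).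
  by rewrite !gez0_abs ?modz_ge0.
by move/divzK; rewrite !mxE.
Qed.

(** A duplicate-free list of maximal length is exhaustive, since a missing element could be added to
    it. *)
Lemma exhaustive_seq (T : eqType) (P : T -> Prop) N :
  (forall s, uniq s -> (forall x, x \in s -> P x) -> (size s <= N)%N) ->
  exists s, [/\ (forall x, x \in s <-> P x) & (size s <= N)%N].
Proof.
move=> bnd.
pose Q n := `[< exists s, [/\ uniq s, forall x, x \in s -> P x & size s = n] >].
have exQ : exists n, Q n by exists 0%N; apply/asboolP; exists [::].
have leQ n : Q n -> (n <= N)%N by move/asboolP => [s [us Ps <-]]; apply: bnd.
have [n /asboolP[s [us Ps sz]] max] := ex_maxnP exQ leQ.
exists s; split; last exact: bnd.
move=> x; split; first exact: Ps.
move=> Px; apply: contrapT => /negP xs.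
have : Q n.+1.
  apply/asboolP; exists (x :: s); rewrite /= xs us sz; split=> // y.
  by rewrite inE => /predU1P[->|/Ps].
by move/max; rewrite ltnn.
Qed.

Lemma absC_det_le (R : realType) n (V : 'M[R[i]]_n) (r : 'I_n -> R) b :
  (forall j k, absC (V j k) <= b * r k) ->
  absC (\det V) <= n`!%:R * (b ^+ n * \prod_k r k).
Proof.
move=> Vb; apply: le_trans (absC_sum _ _ _) _.
rewrite -(card_Sn n) mulr_natl -sumr_const.
apply: ler_sum => s _; rewrite absCM absC_exp absCN.
have -> : absC (1 : R[i]) = 1 by rewrite /absC Normc.normc1.
rewrite expr1n mul1r absC_prod.
have -> : b ^+ n * \prod_k r k = \prod_i (b * r (s i)).
  rewrite big_split /= prodr_const card_ord; congr (_ * _).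
  by rewrite (reindex_inj (@perm_inj _ s)).
by apply: ler_prod => i _; rewrite absC_ge0 Vb.
Qed.

Lemma dPFirr_le_trans (R : realType) (lam b b' : R) :
  b <= b' -> dPFirr_le lam b -> dPFirr_le lam b'.
Proof.
by move=> bb [n [A [? ? ? nb]]]; exists n, A; split=> //; apply: le_trans bb.
Qed.

Section RePlusIm.
Variable R : realType.
Implicit Types z u : R[i].

(* Real-linear, and chosen so that gC (F j k) = (k == j) for the basis F in the
   proof of size_box. *)
Definition gC z : R := ReC z + complex.Im z.

Lemma gCD z u : gC (z + u) = gC z + gC u.
Proof. by case: z u => [a b] [c e]; rewrite /gC /ReC /=; ring. Qed.

Lemma gCZ (x : R) z : gC (Cof x * z) = x * gC z.
Proof. by case: z => [a b]; rewrite /gC /ReC /=; ring. Qed.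

Lemma gC_sum (I : Type) (s : seq I) (P : pred I) (F : I -> R[i]) :
  gC (\sum_(i <- s | P i) F i) = \sum_(i <- s | P i) gC (F i).
Proof. by apply: (big_morph gC gCD); rewrite /gC /ReC /= addr0. Qed.

Lemma absC_ReIm (a b : R) : absC (a +i* b)%C <= `|a| + `|b|.
Proof.
have ab0 : 0 <= `|a| + `|b| by rewrite addr_ge0.
rewrite -[leRHS]ger0_norm // -sqrtr_sqr /absC /= ler_wsqrtr //.
rewrite sqrrD !real_normK ?num_real // addrAC lerDl.
by rewrite mulrn_wge0 // mulr_ge0.
Qed.

Lemma gC_le z : `|gC z| <= 2 * absC z.
Proof.
have Im_le : `|complex.Im z| <= absC z.
  have -> : absC z = absC (z * 'i%C).
    rewrite absCM [X in _ * X](_ : _ = 1) ?mulr1 //.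
    by rewrite /absC /= expr0n expr1n add0r sqrtr1.
  by rewrite -normrN -ReiNIm; apply: ReC_le.
rewrite /gC; apply: le_trans (ler_normD _ _) _.
by have := ReC_le z; lra.
Qed.

End RePlusIm.

Section Embedding.
Variables (R : realType) (d : nat) (B : 'M[R[i]]_d).
Implicit Types c : 'rV[int]_d.

(** In the application, row j of [B] holds the conjugates of the j-th basis element of O_K, and this
    is the k-th conjugate of the element with coordinates [c]. *)
Definition emb c (k : 'I_d) : R[i] := (intmx R[i] c *m B) 0 k.

Lemma embE c k : emb c k = \sum_j (c 0 j)%:~R * B j k.
Proof. by rewrite /emb mxE; apply: eq_bigr => j _; rewrite mxE. Qed.

Lemma embB c c' k : emb (c - c') k = emb c k - emb c' k.
Proof.
by rewrite !embE -sumrB; apply: eq_bigr => j _; rewrite !mxE rmorphB mulrBl.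
Qed.

Lemma emb0 k : emb 0 k = 0.
Proof. by rewrite embE big1 // => j _; rewrite mxE mul0r. Qed.

Lemma emb_sum (s : seq 'rV[int]_d) k : emb (\sum_(c <- s) c) k = \sum_(c <- s) emb c k.
Proof.
have embD c c' : emb (c + c') k = emb c k + emb c' k.
  by rewrite -[c' in LHS]opprK -[- c']sub0r !embB emb0 sub0r opprK.
by apply: (big_morph (emb^~ k) embD); rewrite emb0.
Qed.

Lemma emb_mul (a : 'rV[int]_d) (M : 'M[int]_d) k :
  emb (a *m M) k = \sum_j (a 0 j)%:~R * emb (row j M) k.
Proof.
rewrite /emb intmxM -mulmxA mxE; apply: eq_bigr => j _.
by congr (_ * _); [rewrite mxE | rewrite map_row -row_mul [RHS]mxE].
Qed.

End Embedding.

Section LatticeCount.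
Variables (R : realType) (d : nat) (B : 'M[R[i]]_d) (cj : 'I_d -> 'I_d).
Variable r : 'I_d -> R.
Hypotheses (cjK : involutive cj) (detB : \det B != 0).
Hypotheses (r_gt0 : forall k, 0 < r k) (rcj : forall k, r (cj k) = r k).
Hypothesis cov : forall X : 'I_d -> R[i], (forall k, X (cj k) = (X k)^*) ->
  exists c : 'rV[int]_d, forall k, absC (X k - emb B c k) <= r k.

(* The lattice points approximating t times the standard real basis of the
   conjugation-invariant vectors span a sublattice of index at most
   |det M| that meets the difference set of the box only in 0. *)
Lemma size_box (H : R) (s : seq 'rV[int]_d) : 0 <= H -> uniq s ->
  (forall c k, c \in s -> absC (emb B c k) <= H * r k) ->
  (size s)%:R <= d`!%:R * ((4 * d%:R + 8 * H + 3) ^+ d * \prod_k r k) / absC (\det B).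
Proof.
(* Chosen so that t m > 2 d m + 4 H for every m >= 1: the rounding errors contribute 2 d m and the
   doubled box 4 H. *)
move=> H0 us sH; pose t := 2 * d%:R + 4 * H + 1.
have d0 : 0 <= d%:R :> R by [].
have t0 : 0 < t by rewrite /t; lra.
(* [F j] is invariant under conjugation: it is 1 at [j] if [cj j = j], otherwise (1 + i) / 2 at [j]
   and (1 - i) / 2 at [cj j]; all other coordinates vanish. *)
pose F (j k : 'I_d) : R[i] := ((((k == j)%:R + (k == cj j)%:R) / 2) +i*
  (((k == j)%:R - (k == cj j)%:R) / 2))%C.
have F2 j k : absC (F j k) <= 2.
  apply: le_trans (absC_ReIm _ _) _; apply: (@le_trans _ _ (1 + 1)); last by lra.
  by apply: lerD; rewrite ler_norml; case: (k == j); case: (k == cj j);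
    rewrite /= ?(mulr0n, mulr1n); lra.
have gF j k : gC (F j k) = (k == j)%:R.
  by rewrite /gC /=; case: (k == j); case: (k == cj j);
    rewrite /= ?(mulr0n, mulr1n); lra.
have Fcj j k : F j (cj k) = (F j k)^*.
  have E1 : (cj k == j) = (k == cj j) by rewrite -(can_eq cjK) cjK.
  have E2 : (cj k == cj j) = (k == j) by rewrite (can_eq cjK).
  by rewrite /F E1 E2 /=; congr Complex; lra.
have /choice[cs csP] (j : 'I_d) : exists c, forall k,
    absC (Cof (t * r k) * F j k - emb B c k) <= r k.
  apply: cov => k; rewrite rcj Fcj rmorphM; congr (_ * _).
  by rewrite -[RHS]/(conjc (Cof _)) conjc_real.
pose M : 'M[int]_d := \matrix_j cs j.
(* Diagonal dominance: at an index [l] where |a_l| is maximal, [gC] isolates the term t r_l a_l,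
   which the other terms are too small to balance. *)
have free (a : 'rV[int]_d) :
    (forall k, absC (emb B (a *m M) k) <= 2 * H * r k) -> a = 0.
  move=> small; apply: contrapT => /eqP/rV0Pn[l0 al0].
  have [l _ lmax] := @arg_maxnP _ l0 xpredT (fun l => absz (a 0 l)) isT.
  pose m : R := (absz (a 0 l))%:R.
  have m1 : 1 <= m.
    rewrite /m ler1n; apply: leq_trans (lmax l0 isT).
    by rewrite absz_gt0.
  have am j : `|(a 0 j)%:~R : R| <= m.
    by rewrite -intr_norm -abszE -pmulrn ler_nat; apply: lmax.
  have amE : `|(a 0 l)%:~R : R| = m by rewrite -intr_norm -abszE -pmulrn.
  pose D j := Cof (t * r l) * F j l - emb B (cs j) l.
  have E : t * r l * (a 0 l)%:~R =
      \sum_j (a 0 j)%:~R * gC (D j) + gC (emb B (a *m M) l).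
    rewrite emb_mul gC_sum -big_split (bigD1 l) //= big1 ?addr0.
      rewrite -[_%:~R in X in _ + X](rmorph_int (real_complex R)) gCZ rowK.
      by rewrite -mulrDr -gCD subrK gCZ gF eqxx mulr1 mulrC.
    move=> j jl.
    rewrite -[_%:~R in X in _ + X](rmorph_int (real_complex R)) gCZ rowK.
    by rewrite -mulrDr -gCD subrK gCZ gF eq_sym (negPf jl) !mulr0.
  have rl := r_gt0 l.
  have : t * r l * m <= \sum_(j < d) m * (2 * r l) + 2 * (2 * H * r l).
    rewrite -amE -{1}(gtr0_norm (mulr_gt0 t0 rl)) -normrM E.
    apply: le_trans (ler_normD _ _) _; apply: lerD.
      apply: le_trans (ler_norm_sum _ _ _) _; apply: ler_sum => j _.
      rewrite normrM amE; apply: ler_pM => //.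
      by apply: le_trans (gC_le _) _; rewrite ler_pM2l //; apply: csP.
    by apply: le_trans (gC_le _) _; rewrite ler_pM2l.
  rewrite sumr_const card_ord -[X in X + _]mulr_natl.
  have -> : d%:R * (m * (2 * r l)) + 2 * (2 * H * r l) =
    (2 * d%:R * m + 4 * H) * r l by ring.
  rewrite mulrAC ler_pM2r // /t; nra.
have detM : \det M != 0.
  apply/det0P => -[a a0 aM]; case/eqP: a0; apply: free => k.
  by rewrite aM emb0 absC0 mulr_ge0 ?mulr_ge0 // ltW.
have := size_incongruent detM us.
rewrite -(ler_nat R) => szM; rewrite ler_pdivlMr; last first.
  by rewrite lt_def absC_eq0 detB absC_ge0.
apply: (@le_trans _ _ (absC (\det (intmx R[i] M *m B)))).
  rewrite det_mulmx absCM ler_wpM2r ?absC_ge0 //.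
  apply: le_trans (szM _) _.
    move=> x y z xs ys xyz; apply/eqP; rewrite -subr_eq0 xyz.
    rewrite (free z) ?mul0mx // => k; rewrite -xyz embB.
    apply: le_trans (absCB _ _) _.
    by have := sH x k xs; have := sH y k ys; lra.
  by rewrite det_map_mx absC_int -intr_norm -abszE -pmulrn.
apply: absC_det_le => j k.
have -> : (intmx R[i] M *m B) j k = emb B (cs j) k.
  by rewrite /emb -[in RHS](rowK cs j) map_row -row_mul [RHS]mxE.
have := csP j k; rewrite absC_dist => csjk.
rewrite -[emb _ _ _](subrK (Cof (t * r k) * F j k)).
apply: le_trans (absCD _ _) _.
have rk := r_gt0 k.
rewrite absCM absC_ge0_Cof; last by rewrite mulr_ge0 // ltW.
have : t * r k * absC (F j k) <= t * r k * 2 by rewrite ler_pM2l ?mulr_gt0.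
have -> : 4 * d%:R + 8 * H + 3 = 2 * t + 1 by rewrite /t; ring.
lra.
Qed.

End LatticeCount.

(** * Lattice points in the cone around the dominant eigenline *)

Section LatticeCone.
Variables (R : realType) (d : nat) (B : 'M[R[i]]_d) (cj : 'I_d -> 'I_d).
Variables (r : 'I_d -> R) (k0 : 'I_d).
Hypotheses (cjK : involutive cj) (cj0 : cj k0 = k0).
Hypothesis Bcj : forall j k, B j (cj k) = (B j k)^*.
Hypotheses (r_gt0 : forall k, 0 < r k) (rcj : forall k, r (cj k) = r k).
Hypothesis cov : forall X : 'I_d -> R[i], (forall k, X (cj k) = (X k)^*) ->
  exists c : 'rV[int]_d, forall k, absC (X k - emb B c k) <= r k.
Implicit Types c : 'rV[int]_d.

Let height c : R := ReC (emb B c k0) / r k0.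

(** [theta] is the aperture. Multiplication by lam maps [cone 1] into [cone rho], and the gap
    between the two leaves room for rounding to the lattice. *)
Let cone theta c := forall k, k != k0 -> absC (emb B c k) <= theta * (height c * r k).

Lemma emb_cj c k : emb B c (cj k) = (emb B c k)^*.
Proof.
rewrite !embE rmorph_sum; apply: eq_bigr => j _.
by rewrite Bcj rmorphM rmorph_int.
Qed.

Let emb_k0 c : emb B c k0 = Cof (height c * r k0).
Proof.
have := emb_cj c k0; rewrite cj0 /height divfK ?gt_eqF //.
case: (emb B c k0) => [a b] [/eqP]; rewrite -subr_eq0 opprK -mulr2n.
by rewrite mulrn_eq0 /= => /eqP ->.
Qed.

Let height_sum (s : seq 'rV[int]_d) : height (\sum_(c <- s) c) = \sum_(c <- s) height c.
Proof.
rewrite /height emb_sum -mulr_suml; congr (_ / _).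
by apply: (big_morph (@ReC R)) => // -[a b] [a' b'].
Qed.

(* A point deep inside the cone is cut into nearly equal lattice pieces, each of
   which is within 2 r of a fixed fraction of it. *)
Let decompose rho c : 0 <= rho < 1 -> 0 < height c -> cone rho c ->
  exists2 t : seq 'rV[int]_d, c = \sum_(y <- t) y &
    forall y, y \in t -> [/\ 0 < height y, height y <= 10 / (1 - rho) & cone 1 y].
Proof.
move=> /andP[rho0 rho1] hc cc; have rho1' : 0 < 1 - rho by lra.
(* Pieces of height at least hh tolerate an error 2 r in the cone condition, as
   (1 - rho) * hh = 2 + 2. *)
pose hh := 4 / (1 - rho).
have HE : 10 / (1 - rho) = hh * (5 / 2) by rewrite /hh; field; lra.
have hhE : hh * (1 - rho) = 4 by rewrite /hh divfK // gt_eqF.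
have hh4 : 4 <= hh by rewrite /hh ler_pdivlMr //; lra.
have [le|gt] := leP (height c) (10 / (1 - rho)).
  exists [:: c]; first by rewrite big_seq1.
  move=> y; rewrite inE => /eqP ->; split=> // k kk0.
  apply: le_trans (cc k kk0) _; rewrite ler_wpM2r ?ltW //.
  by rewrite mulr_gt0.
have hh0 : 0 < hh by lra.
have q0 : 0 <= height c / hh by rewrite divr_ge0 // ltW.
(* Cutting into m = floor (height c / hh) >= 2 pieces gives an average height g between hh and 3/2
   hh. Rounding changes each height by at most 2, so it stays positive and, as hh >= 4, at most 5/2
   hh = 10 / (1 - rho). *)
have /andP[] := Num.Theory.truncn_itv q0; set m := Num.trunc _ => mle mgt.
have hc2 : 5 / 2 < height c / hh by rewrite ltr_pdivlMr // mulrC -HE.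
have m2 : (1 < m)%N.
  rewrite -(ltr_nat R); move: mgt; rewrite -natr1; lra.
have m0 : 0 < m%:R :> R by rewrite ltr0n; lia.
pose g := height c / m%:R.
have gm : g * m%:R = height c by rewrite /g divfK // gt_eqF.
have qh : height c / hh * hh = height c by rewrite divfK // gt_eqF.
have g1 : hh <= g by rewrite /g ler_pdivlMr // mulrC -ler_pdivlMr.
have g2 : g <= hh * (3 / 2).
  have m2' : 2 <= m%:R :> R by rewrite (ler_nat _ 2).
  have : hh * (height c / hh) <= hh * (3 / 2 * m%:R).
    by rewrite ler_pM2l //; move: mgt; rewrite -natr1; lra.
  by rewrite /g ler_pdivrMr // mulrC qh mulrA.
have /choice[S0 S0P] (j : nat) : exists s, forall k,
    absC (Cof (j%:R / m%:R) * emb B c k - emb B s k) <= r k.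
  apply: cov => k; rewrite emb_cj rmorphM; congr (_ * _).
  by rewrite -[RHS]/(conjc (Cof _)) conjc_real.
(* The two end points are kept exact, so that the differences telescope to [c] itself. *)
pose S j := if j == 0%N then 0 else if j == m then c else S0 j.
have SP j k : absC (Cof (j%:R / m%:R) * emb B c k - emb B (S j) k) <= r k.
  rewrite /S; case: eqP => [->|_].
    by rewrite mul0r mul0r emb0 subrr absC0 ltW.
  case: eqP => [->|_]; last exact: S0P.
  by rewrite divff ?gt_eqF // mul1r subrr absC0 ltW.
pose y j := S j.+1 - S j.
have yP j k : absC (emb B (y j) k - Cof m%:R^-1 * emb B c k) <= 2 * r k.
  rewrite embB.
  set u := Cof (j.+1%:R / m%:R) * emb B c k - emb B (S j.+1) k.
  set v := Cof (j%:R / m%:R) * emb B c k - emb B (S j) k.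
  have -> : emb B (S j.+1) k - emb B (S j) k - Cof m%:R^-1 * emb B c k = v - u.
    have -> : Cof m%:R^-1 = Cof (j.+1%:R / m%:R) - Cof (j%:R / m%:R) :> R[i].
      by rewrite -rmorphB -mulrBl -natrB ?subSnn ?mul1r.
    by rewrite /u /v; ring.
  apply: le_trans (absCB _ _) _.
  by have := SP j k; have := SP j.+1 k; rewrite -/u -/v; lra.
have hy j : `|height (y j) - g| <= 2.
  have := yP j k0; rewrite !emb_k0 -rmorphM -rmorphB absC_Cof.
  have -> : height (y j) * r k0 - m%:R^-1 * (height c * r k0) =
    (height (y j) - g) * r k0 by rewrite /g; ring.
  by rewrite normrM (gtr0_norm (r_gt0 k0)) ler_pM2r.
exists [seq y j | j <- index_iota 0 m].
  rewrite big_map telescope_sumr // /S eqxx subr0.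
  by case: eqP => // m00; rewrite m00 in m2.
move=> _ /mapP[j _ ->]; have := hy j; rewrite ler_norml => /andP[hy1 hy2].
have hy0 : 0 < height (y j) by lra.
split=> //; first by rewrite HE; lra.
move=> k kk0; rewrite mul1r.
rewrite -[emb _ _ _](subrK (Cof m%:R^-1 * emb B c k)).
apply: le_trans (absCD _ _) _; rewrite absCM absC_ge0_Cof ?invr_ge0 ?ler0n //.
have rk := r_gt0 k.
have c1 : m%:R^-1 * absC (emb B c k) <= rho * (g * r k).
  have -> : rho * (g * r k) = m%:R^-1 * (rho * (height c * r k)) by rewrite /g; ring.
  by rewrite ler_pM2l ?invr_gt0 //; apply: cc.
apply: le_trans (lerD (yP j k) c1) _.
have -> : 2 * r k + rho * (g * r k) = (2 + rho * g) * r k by ring.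
rewrite ler_pM2r //; nra.
Qed.

Let bounded_cone H c : 0 < height c -> height c <= H -> cone 1 c ->
  forall k, absC (emb B c k) <= H * r k.
Proof.
move=> hc hH cc k; have rk := r_gt0 k; apply: (@le_trans _ _ (height c * r k)).
  have [->|/cc] := eqVneq k k0; last by rewrite mul1r.
  by rewrite emb_k0 absC_ge0_Cof // mulr_ge0 // ltW.
by rewrite ler_pM2r.
Qed.

(** Rounding the vector with coordinate 2 r_0 at [k0] and 0 elsewhere gives a height between 1 and
    3, while every other coordinate is at most r_k. *)
Let cone_nonempty : exists c, [/\ 0 < height c, height c <= 3 & cone 1 c].
Proof.
pose X k : R[i] := if k == k0 then Cof (2 * r k0) else 0.
have [c cP] : exists c, forall k, absC (X k - emb B c k) <= r k.
  apply: cov => k; rewrite /X.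
  have -> : (cj k == k0) = (k == k0) by rewrite -{1}cj0 (can_eq cjK).
  case: ifP => _; last by rewrite rmorph0.
  by rewrite -[RHS]/(conjc (Cof _)) conjc_real.
have := cP k0; rewrite /X eqxx emb_k0 -rmorphB absC_Cof -mulrBl normrM.
have r0 := r_gt0 k0; rewrite (gtr0_norm r0) -[X in _ <= X]mul1r ler_pM2r //.
rewrite ler_norml => /andP[h1 h2]; exists c; split; [lra|lra|].
move=> k kk0; rewrite mul1r; have := cP k; rewrite /X (negPf kk0) sub0r absCN.
move/le_trans; apply; rewrite ler_peMl //; [exact: ltW | lra].
Qed.

(** The heights of the points of Z are the positive reals to which [dPFirr_le_of_positive_seq]
    applies: multiplication by [lam] followed by [decompose] writes lam times a height as a sum of
    heights. Their number comes from [size_box] with H = 10 / (1 - rho). *)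
Lemma dPFirr_le_of_covering (A : 'M[int]_d) (e : 'I_d -> R[i]) (lam rho : R) :
  \det B != 0 ->
  (forall c k, emb B (c *m A) k = e k * emb B c k) ->
  0 < lam -> 0 <= rho < 1 -> e k0 = Cof lam ->
  (forall k, k != k0 -> absC (e k) <= rho * lam) ->
  dPFirr_le lam (d`!%:R * ((4 * d%:R + 80 / (1 - rho) + 3) ^+ d * \prod_k r k) /
    absC (\det B)).
Proof.
move=> detB mulA lam0 rho01 e0 erho; have /andP[rho0 rho1] := rho01.
have rho1' : 0 < 1 - rho by lra.
pose H := 10 / (1 - rho).
have H10 : 10 <= H by rewrite /H ler_pdivlMr //; lra.
have H0 : 0 <= H by lra.
pose Z c := [/\ 0 < height c, height c <= H & cone 1 c].
pose b := d`!%:R * ((4 * d%:R + 80 / (1 - rho) + 3) ^+ d * \prod_k r k) / absC (\det B).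
have b0 : 0 <= b.
  rewrite /b divr_ge0 ?absC_ge0 // !mulr_ge0 ?prodr_ge0 //; last by move=> k _; apply: ltW.
  by rewrite exprn_ge0 // !addr_ge0 ?mulr_ge0 ?invr_ge0 // ltW.
have [s [sZ sb]] : exists s, [/\ forall c, c \in s <-> Z c & (size s <= Num.trunc b)%N].
  apply: exhaustive_seq => s us sZ; rewrite Num.Theory.truncn_ge_nat //.
  have -> : b = d`!%:R * ((4 * d%:R + 8 * H + 3) ^+ d * \prod_k r k) / absC (\det B).
    have -> : 8 * H = 80 / (1 - rho) by rewrite /H mulrA -natrM.
    by [].
  apply: (size_box cjK) => // c k /sZ[h1 h2 h3].
  exact: bounded_cone.
have heightA c : height (c *m A) = lam * height c.
  rewrite /height mulA e0 emb_k0 -rmorphM /ReC /=; field.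
  by rewrite gt_eqF.
apply: (@dPFirr_le_trans _ _ (size [seq height c | c <- s])%:R).
  rewrite size_map; apply: (@le_trans _ _ (Num.trunc b)%:R); first by rewrite ler_nat.
  by rewrite Num.Theory.truncn_le.
apply: dPFirr_le_of_positive_seq; first exact: ltW.
- have [c [h1 h2 h3]] := cone_nonempty.
  have : c \in s by apply/sZ; split=> //; lra.
  by case: (s).
- by move=> _ /mapP[c /sZ[h1 _ _] ->].
- move=> _ /mapP[c /sZ[h1 h2 h3] ->].
  have [||t cE tZ] := @decompose rho (c *m A) rho01.
  + by rewrite heightA mulr_gt0.
  + move=> k kk0; rewrite mulA absCM heightA.
    have -> : rho * (lam * height c * r k) = rho * lam * (1 * (height c * r k)) by ring.
    by apply: ler_pM; rewrite ?absC_ge0 // ?erho // h3.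
  exists [seq height y | y <- t]; last by rewrite big_map -heightA cE height_sum.
  move=> _ /mapP[y yt ->]; apply: map_f; apply/sZ.
  by have [] := tZ y yt.
Qed.

End LatticeCone.

(** * The lattice of integers of Q(lam) and its trace dual *)

Section RationalRoots.
Variables (P : {poly rat}) (irrP : irreducible_poly P).

(** An irreducible polynomial is coprime to whatever it does not divide, and coprimality persists
    over [F], where it excludes a common root. *)
Lemma root_dvd_minpoly (F : numFieldType) (z : F) (p : {poly rat}) :
  root (map_poly ratr P) z -> (map_poly ratr p).[z] = 0 -> P %| p.
Proof.
move=> rz pz; apply: contraT => ndiv.
have : coprimep (map_poly (ratr : rat -> F) P) (map_poly ratr p).
  by rewrite coprimep_map irreducible_poly_coprime.
by move/coprimep_root/(_ rz); rewrite pz eqxx.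
Qed.

Lemma dvd_minpoly_root (F : numFieldType) (z : F) (p : {poly rat}) :
  root (map_poly ratr P) z -> P %| p -> (map_poly ratr p).[z] = 0.
Proof.
move=> rz /dvdpP[q ->]; rewrite rmorphM hornerM.
by rewrite [X in _ * X](rootP rz) mulr0.
Qed.

End RationalRoots.

Section AlgebraicIntegers.
Variable F : comNzRingType.
Implicit Types x y : F.

Lemma alg_intP x :
  is_alg_int x <-> integralOver (intmul 1 : {rmorphism int -> F}) x.
Proof. by split=> [[q [? ?]]|[q ? ?]]; exists q. Qed.

Lemma alg_intM x y : is_alg_int x -> is_alg_int y -> is_alg_int (x * y).
Proof. by rewrite !alg_intP; apply: integral_mul. Qed.

Lemma alg_int1 : is_alg_int (1 : F).
Proof. by apply/alg_intP; apply: integral1. Qed.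

Lemma alg_intX x n : is_alg_int x -> is_alg_int (x ^+ n).
Proof.
move=> ix; elim: n => [|n IH]; first exact: alg_int1.
by rewrite exprS; apply: alg_intM.
Qed.

End AlgebraicIntegers.

Section NumberField.
Variables (R : realType) (lam : R) (P : {poly rat}) (d : nat).
Variables (e : 'I_d -> R[i]) (w : 'I_d -> {poly rat}).
Hypotheses (minP : is_minpoly P lam) (sizeP : size P = d.+1).
Hypotheses (int_lam : is_alg_int lam) (enum_e : is_embedding_enum P e).
Hypothesis basis_w : is_Zbasis lam w.
Implicit Types (p q : {poly rat}) (j k : 'I_d) (z : R[i]).

Definition basis_mx : 'M[R[i]]_d := \matrix_(j, k) evC (w j) (e k).
Local Notation B := basis_mx.

Lemma discKE : absC (discK e w) = absC (\det B) ^+ 2.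
Proof.
rewrite /discK absC_exp -det_tr; congr (absC (\det _) ^+ _).
by apply/matrixP => i j; rewrite !mxE.
Qed.

Lemma e_inj : injective e. Proof. by case: enum_e. Qed.

Lemma e_root k : root (map_poly ratr P) (e k). Proof. by case: enum_e => _; apply. Qed.

(** Elements of K are represented by polynomials in [lam]; this makes the embeddings well defined on
    them, as [P] divides the difference of two representatives. *)
Lemma evC_eq p q k : evR p lam = evR q lam -> evC p (e k) = evC q (e k).
Proof.
have [_ irrP rP] := minP; move=> epq; apply/eqP; rewrite -subr_eq0 /evC.
rewrite -hornerN -hornerD -rmorphN -rmorphD /=.
rewrite (dvd_minpoly_root (e_root k)) // (root_dvd_minpoly irrP rP) //.
by rewrite rmorphB hornerD hornerN [X in X - _]epq subrr.
Qed.

Lemma evC_neq0 p k : p != 0 -> (size p <= d)%N -> evC p (e k) != 0.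
Proof.
have [_ irrP _] := minP; move=> p0 sp; apply/eqP => pk.
have := dvdp_leq p0 (root_dvd_minpoly irrP (e_root k) pk).
by rewrite sizeP ltnNge sp.
Qed.

(** [P] has degree [d] and the [e k] are [d] distinct roots of it. *)
Lemma conj_enum z : root (map_poly ratr P) z -> exists k, z = e k.
Proof.
move=> rz.
have E : map_poly ratr P = lead_coef (map_poly ratr P) *:
    \prod_(z <- [seq e k | k <- enum 'I_d]) ('X - z%:P).
  apply: all_roots_prod_XsubC.
  - by rewrite size_map_poly size_map size_enum_ord.
  - by apply/allP => _ /mapP[k _ ->]; apply: e_root.
  by rewrite uniq_rootsE map_inj_uniq ?enum_uniq //; apply: e_inj.
have P0 : lead_coef (map_poly ratr P : {poly R[i]}) != 0.
  by rewrite lead_coef_eq0 map_poly_eq0 -size_poly_eq0 sizeP.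
move: rz; rewrite E rootZ // root_prod_XsubC => /mapP[k _ ->].
by exists k.
Qed.

Lemma evC_conj p z : evC p z^* = (evC p z)^*.
Proof.
rewrite /evC -horner_map /=; congr (_.[_]); apply/polyP => i.
by rewrite !coef_map /= fmorph_rat.
Qed.

Lemma exists_k0 : exists k0, e k0 = Cof lam.
Proof.
have [_ _ rP] := minP.
have [|k kE] := @conj_enum (Cof lam); last by exists k.
apply/rootP; have -> : map_poly ratr P = map_poly (real_complex R) (map_poly ratr P).
  by apply/polyP => i; rewrite !coef_map /= fmorph_rat.
by rewrite horner_map (rootP rP) rmorph0.
Qed.

Lemma exists_cj : exists2 cj : 'I_d -> 'I_d, involutive cj &
  forall k, e (cj k) = (e k)^*.
Proof.
have /choice[cj cjP] k : exists k', e k' = (e k)^*.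
  have [|k' ->] := @conj_enum (e k)^*; last by exists k'.
  by apply/rootP; rewrite -/(evC P _) evC_conj [evC _ _](rootP (e_root k)) rmorph0.
by exists cj => // k; apply: e_inj; rewrite !cjP conjCK.
Qed.

Lemma alg_int_emb p : is_alg_int (evR p lam) ->
  exists c : 'rV[int]_d, forall k, evC p (e k) = emb B c k.
Proof.
have [_ bas] := basis_w; move/bas => [c [cE _]].
exists (\row_j c j) => k; rewrite embE.
pose q := \sum_(j < d) (c j)%:~R *: w j.
have qE (F : numFieldType) (z : F) : (map_poly ratr q).[z] =
    \sum_(j < d) (c j)%:~R * (map_poly ratr (w j)).[z].
  rewrite rmorph_sum horner_sum; apply: eq_bigr => j _.
  by rewrite /= map_polyZ hornerZ /= ratr_int.
rewrite (@evC_eq p q); last by rewrite cE /evR qE.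
by rewrite /evC qE; apply: eq_bigr => j _; rewrite !mxE.
Qed.

Lemma evR_Xn_alg_int n : is_alg_int (evR 'X^n lam).
Proof. by rewrite /evR map_polyXn hornerXn; apply: alg_intX. Qed.

Lemma evRM_alg_int p q : is_alg_int (evR p lam) -> is_alg_int (evR q lam) ->
  is_alg_int (evR (p * q) lam).
Proof. by move=> ip iq; rewrite /evR rmorphM hornerM; apply: alg_intM. Qed.

Lemma w_alg_int j : is_alg_int (evR (w j) lam).
Proof. by case: basis_w. Qed.

Let V : 'M[R[i]]_d := Vandermonde d (\row_k e k).

Lemma det_vandermonde_neq0 : \det V != 0.
Proof.
rewrite det_Vandermonde; apply/prodf_neq0 => i _; apply/prodf_neq0 => j ij.
rewrite !mxE subr_eq0; apply: contraTneq ij => /e_inj ->.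
by rewrite ltnn.
Qed.

(** The powers of [lam] are integer combinations of the basis, so the Vandermonde matrix of the
    distinct conjugates is an integer matrix times [B]. *)
Lemma det_basis_neq0 : \det B != 0.
Proof.
have /choice[c cP] (i : 'I_d) := alg_int_emb (evR_Xn_alg_int i).
have : \det (intmx R[i] (\matrix_i c i) *m B) != 0.
  suff -> : intmx R[i] (\matrix_i c i) *m B = V by apply: det_vandermonde_neq0.
  apply/matrixP => i k; rewrite [RHS]mxE !mxE -(hornerXn (e k) i).
  rewrite -(map_polyXn ratr) -/(evC _ _) cP embE.
  by apply: eq_bigr => j _; rewrite !mxE.
by rewrite det_mulmx mulf_eq0 negb_or => /andP[].
Qed.

Lemma mul_lam_mx : exists A : 'M[int]_d, forall c k,
  emb B (c *m A) k = e k * emb B c k.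
Proof.
have /choice[a aP] (j : 'I_d) := alg_int_emb
  (evRM_alg_int (evR_Xn_alg_int 1) (w_alg_int j)).
exists (\matrix_j a j) => c k; rewrite emb_mul embE mulr_sumr.
apply: eq_bigr => j _; rewrite rowK -aP mulrCA mxE; congr (_ * _).
by rewrite /evC rmorphM /= map_polyX hornerM hornerX.
Qed.

Section Dual.
Variable y : 'I_d -> R[i].
Hypothesis y_int : forall j, exists z : int, \sum_k y k * B j k = z%:~R.

Lemma dual_int p : is_alg_int (evR p lam) ->
  exists z : int, \sum_k y k * evC p (e k) = z%:~R.
Proof.
move=> /alg_int_emb[c cP]; have /choice[z zP] := y_int.
exists (\sum_j c 0 j * z j); rewrite rmorph_sum /=.
under eq_bigr do rewrite cP embE mulr_sumr.
rewrite exchange_big; apply: eq_bigr => j _ /=.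
by rewrite rmorphM /= -zP mulr_sumr; apply: eq_bigr => k _; ring.
Qed.

(* If some y k2 vanished, the integer matrix of the traces of y X^i w_j would be
   singular, hence annihilated by an integer row; the latter gives a nonzero
   q of degree below d with y k * q(e k) = 0 for all k. *)
Lemma dual_neq0 k1 k2 : y k1 != 0 -> y k2 != 0.
Proof.
move=> yk1; apply: contraTneq isT => yk2.
have /choice[Z ZP] (ij : 'I_d * 'I_d) : exists z : int,
    \sum_k y k * evC ('X^(ij.1) * w ij.2) (e k) = z%:~R.
  by apply/dual_int/evRM_alg_int; [apply: evR_Xn_alg_int | apply: w_alg_int].
pose M : 'M[int]_d := \matrix_(i, j) Z (i, j).
have ME : intmx R[i] M = V *m diag_mx (\row_k y k) *m B^T.
  apply/matrixP => i j; rewrite !mxE -(ZP (i, j)); apply: eq_bigr => k _.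
  rewrite mul_mx_diag !mxE /evC rmorphM hornerM /= map_polyXn hornerXn; ring.
have : \det M == 0.
  rewrite -(intr_eq0 R[i]) -(det_map_mx (intmul 1 : {rmorphism int -> R[i]})) ME.
  by rewrite !det_mulmx det_diag (bigD1 k2) //= mxE yk2 mul0r mulr0 mul0r.
case/det0P => a a0 aM.
pose q := rVpoly (intmx rat a).
have q0 : q != 0.
  apply: contra_neq a0 => q0; apply/rowP => i; rewrite mxE.
  have := coef_rVpoly_ord (intmx rat a) i; rewrite -/q q0 coef0 mxE => /esym/eqP.
  by rewrite intr_eq0 => /eqP.
have sq : (size q <= d)%N by apply: size_poly.
have /rowP/(_ k1) : intmx R[i] a *m V *m diag_mx (\row_k y k) = 0.
  have uB : B^T \in unitmx by rewrite unitmx_tr unitmxE unitfE det_basis_neq0.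
  apply: (can_inj (mulmxK uB)).
  by rewrite mul0mx -!mulmxA (mulmxA V) -ME -intmxM aM map_mx0.
rewrite mul_mx_diag !mxE => /eqP; rewrite mulf_eq0 (negPf yk1) orbF.
have -> : \sum_j intmx R[i] a 0 j * V j k1 = evC q (e k1).
  rewrite /evC (@horner_coef_wide _ d); last by rewrite size_map_poly.
  apply: eq_bigr => i _; rewrite coef_map /= coef_rVpoly_ord !mxE.
  by rewrite ratr_int.
by move/negPn; rewrite evC_neq0.
Qed.

(* The matrix of the traces of y w_i w_j is integral, with determinant D_K times
   the norm of y. *)
Lemma dual_norm_ge k1 : y k1 != 0 ->
  1 <= absC (\det B) ^+ 2 * \prod_k absC (y k).
Proof.
move=> yk1.
have /choice[Z ZP] (ij : 'I_d * 'I_d) : exists z : int,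
    \sum_k y k * evC (w ij.1 * w ij.2) (e k) = z%:~R.
  by apply/dual_int/evRM_alg_int; apply: w_alg_int.
pose T : 'M[int]_d := \matrix_(i, j) Z (i, j).
have TE : intmx R[i] T = B *m diag_mx (\row_k y k) *m B^T.
  apply/matrixP => i j; rewrite !mxE -(ZP (i, j)); apply: eq_bigr => k _.
  rewrite mul_mx_diag !mxE /evC rmorphM hornerM /=; ring.
have dT : (\det T)%:~R = \det B ^+ 2 * \prod_k y k.
  rewrite -(det_map_mx (intmul 1 : {rmorphism int -> R[i]})) TE.
  rewrite !det_mulmx det_diag det_tr mulrAC -expr2; congr (_ * _).
  by apply: eq_bigr => k _; rewrite mxE.
have T0 : \det T != 0.
  rewrite -(intr_eq0 R[i]) dT mulf_neq0 ?expf_neq0 ?det_basis_neq0 //.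
  by apply/prodf_neq0 => k _; apply: dual_neq0 yk1.
rewrite -absC_prod -absC_exp -absCM -dT absC_int -intr_norm ler1z.
by rewrite -gtz0_ge1 normr_gt0.
Qed.

End Dual.
End NumberField.

(** * The two bounds *)

Lemma fact_le_expn n : (n`! <= n ^ n)%N.
Proof.
elim: n => // n IH; rewrite factS expnS leq_mul2l; apply/orP; right.
by apply: leq_trans IH _; case: n => // n; rewrite leq_exp2r.
Qed.

Section Constants.
Variables (R : realType) (d : nat) (rho : R).
Hypotheses (d3 : (3 <= d)%N) (rho01 : 0 <= rho < 1).

Let u := (1 - rho)^-1.

Let u1 : 1 <= u.
Proof. by case/andP: rho01 => h0 h1; rewrite /u invf_ge1; lra. Qed.

Let d3R : 3 <= d%:R :> R. Proof. by rewrite (ler_nat _ 3). Qed.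

(** One factor d comes from d! <= d^d. With d >= 3 and u = 1 / (1 - rho) >= 1, the base is at most
    (4 + 80/3 + 1) d u <= 33 d u. *)
Lemma cone_constant_le :
  d`!%:R * (4 * d%:R + 80 / (1 - rho) + 3) ^+ d <= (33 * d%:R ^+ 2 / (1 - rho)) ^+ d.
Proof.
have [u1' d3'] := (u1, d3R).
rewrite -/u; have b0 : 0 <= 4 * d%:R + 80 * u + 3 by lra.
apply: (@le_trans _ _ (d%:R ^+ d * (4 * d%:R + 80 * u + 3) ^+ d)).
  rewrite ler_wpM2r //; first exact: exprn_ge0.
  by rewrite -natrX ler_nat fact_le_expn.
have c0 : 0 <= 33 * d%:R * u by rewrite !mulr_ge0 //; lra.
rewrite -exprMn (_ : 33 * d%:R ^+ 2 * u = d%:R * (33 * d%:R * u)); last by ring.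
have : 4 * d%:R + 80 * u + 3 <= 33 * d%:R * u by nra.
by move=> le; apply: lerXn2r; [exact: mulr_ge0 | exact: mulr_ge0 | exact: ler_wpM2l].
Qed.

(** After cancelling 2^d it remains that 33 d^2 <= (4 d)^3 <= (4 d)^d and u <= u^d. The spare 2^d
    absorbs the covering radius in the discriminant bound and the passage to the infimum in the
    thickness bound. *)
Lemma final_constant_le :
  33 * d%:R ^+ 2 / (1 - rho) * 2 ^+ d <= (8 * d%:R / (1 - rho)) ^+ d.
Proof.
have [u1' d3'] := (u1, d3R); rewrite -/u.
have -> : (8 * d%:R * u) ^+ d = 2 ^+ d * (4 * d%:R) ^+ d * u ^+ d.
  by rewrite -!exprMn; congr (_ ^+ _); ring.
have p2 : 0 < 2 ^+ d :> R by rewrite exprn_gt0.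
have h1 : (4 * d%:R) ^+ 3 <= (4 * d%:R) ^+ d :> R.
  by rewrite ler_weXn2l //; lra.
have h2 : 33 * d%:R ^+ 2 <= (4 * d%:R) ^+ d :> R.
  by apply: le_trans h1; rewrite exprMn; nra.
have h3 : u <= u ^+ d.
  by rewrite -[X in X <= _]expr1 ler_weXn2l //; lia.
rewrite mulrC mulrA -mulrA -[leRHS]mulrA ler_pM2l // ler_pM //; last lra.
by rewrite mulr_ge0 ?exprn_ge0.
Qed.

End Constants.

(** The empty matrix has characteristic polynomial 1, hence no eigenvalue and no spectral radius. *)
Lemma dPFirr_le_ge1 (R : realType) (lam b : R) : dPFirr_le lam b -> 1 <= b.
Proof.
move=> [[|n] [A [_ _ [[z]]]]]; last by move=> _ _ _; apply: le_trans; rewrite ler1n.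
by rewrite /char_poly det_mx00 (negPf (root1 z)).
Qed.

Section Main.
Variables (R : realType) (lam : R) (P : {poly rat}) (d : nat) (rho : R).
Variables (e : 'I_d -> R[i]) (w : 'I_d -> {poly rat}).
Hypotheses (minP : is_minpoly P lam) (sizeP : size P = d.+1) (d3 : (3 <= d)%N).
Hypotheses (perron : is_Perron P lam) (ratio : is_spectral_ratio P lam rho).
Hypotheses (enum_e : is_embedding_enum P e) (basis_w : is_Zbasis lam w).

Local Notation B := (basis_mx e w).

Let lam0 : 0 < lam. Proof. by case: perron => lam1 _ _; apply: lt_le_trans lam1. Qed.
Let int_lam : is_alg_int lam. Proof. by case: perron. Qed.
Let detB : \det B != 0.
Proof. exact: det_basis_neq0 minP int_lam enum_e basis_w. Qed.
Let detB_gt0 : 0 < absC (\det B).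
Proof. by rewrite lt_def absC_eq0 detB absC_ge0. Qed.

Lemma spectral_ratio_itv : 0 <= rho < 1.
Proof.
have [[z cz [zlam <-]] _] := ratio; have [_ _ /(_ z cz zlam) zlt] := perron.
by rewrite divr_ge0 ?absC_ge0 ?(ltW lam0) //= ltr_pdivrMr // mul1r.
Qed.

Lemma basis_mx_cj cj : (forall k, e (cj k) = (e k)^*) ->
  forall j k, B j (cj k) = (B j k)^*.
Proof. by move=> cjE j k; rewrite !mxE cjE evC_conj. Qed.

Lemma KR_cj cj X : (forall k, e (cj k) = (e k)^*) ->
  KR e X <-> forall k, X (cj k) = (X k)^*.
Proof.
move=> cjE; split=> [KX k|KX i j]; first by apply: KX; rewrite cjE.
by rewrite -cjE => /(e_inj enum_e) ->.
Qed.

(** Reduces both bounds to finding conjugation-invariant covering radii with a small product. *)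
Lemma dPFirr_le_radii (r : 'I_d -> R) :
  (forall k, 0 < r k) -> (forall i j, e j = (e i)^* -> r j = r i) ->
  (forall X, KR e X -> exists c : 'rV[int]_d,
     forall k, absC (X k - emb B c k) <= r k) ->
  dPFirr_le lam ((33 * d%:R ^+ 2 / (1 - rho)) ^+ d *
    (\prod_k r k / absC (\det B))).
Proof.
move=> r0 rconj cov.
have [cj cjK cjE] := exists_cj sizeP enum_e.
have [k0 k0E] := exists_k0 minP sizeP enum_e.
have [A AE] := mul_lam_mx minP int_lam enum_e basis_w.
have cj0 : cj k0 = k0.
  apply: (e_inj enum_e); rewrite cjE k0E.
  by rewrite -[LHS]/(conjc (Cof _)) conjc_real.
have := @dPFirr_le_of_covering _ _ B cj r k0 cjK cj0 (basis_mx_cj cjE) r0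
  (fun k => rconj _ _ (cjE k)) _ A e lam rho detB AE lam0 spectral_ratio_itv k0E.
move=> main; apply: dPFirr_le_trans (main _ _).
- rewrite (mulrA d`!%:R) -(mulrA (d`!%:R * _)) ler_wpM2r //.
    by rewrite divr_ge0 ?absC_ge0 // prodr_ge0 // => k _; apply: ltW.
  apply: cone_constant_le => //; exact: spectral_ratio_itv.
- by move=> X /(KR_cj _ cjE); apply: cov.
move=> k kk0; rewrite -ler_pdivrMr //; case: ratio => _; apply.
  exact: (e_root enum_e).
by rewrite -k0E; apply: contra_neq kk0 => /(e_inj enum_e).
Qed.

(** Taking real parts of coefficients averages each coordinate with the conjugate of its partner.
    This fixes vectors of K_R and does not increase a uniform bound on the coordinates. *)
Lemma basis_mx_Re cj (v : 'I_d -> R[i]) k : (forall k, e (cj k) = (e k)^*) ->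
  2 * \sum_j Cof (ReC (v j)) * B j k =
  \sum_j v j * B j k + (\sum_j v j * B j (cj k))^*.
Proof.
move=> cjE; rewrite rmorph_sum -big_split mulr_sumr; apply: eq_bigr => j _ /=.
rewrite (basis_mx_cj cjE) rmorphM /= conjCK -mulrDl mulrA; congr (_ * _).
by rewrite /Cof /ReC ReJ_add mulrC divfK // pnatr_eq0.
Qed.

Lemma KR_coord X : KR e X ->
  exists t : 'I_d -> R, forall k, X k = \sum_j Cof (t j) * B j k.
Proof.
have [cj _ cjE] := exists_cj sizeP enum_e.
move=> /(KR_cj _ cjE) KX.
pose v : 'rV[R[i]]_d := (\row_k X k) *m invmx B.
have vE k : X k = \sum_j v 0 j * B j k.
  have uB : B \in unitmx by rewrite unitmxE unitfE.
  have <- : (v *m B) 0 k = X k by rewrite mulmxKV // mxE.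
  by rewrite mxE.
exists (fun j => ReC (v 0 j)) => k.
have two0 : 2 != 0 :> R[i] by rewrite pnatr_eq0.
apply: (mulfI two0); rewrite (basis_mx_Re _ _ cjE) -!vE KX conjCK.
by rewrite mulr_natl mulr2n.
Qed.

Let D := absC (\det B) ^+ 2.
Let D_gt0 : 0 < D. Proof. exact: exprn_gt0. Qed.

Let delta := D `^ d%:R^-1.
Let delta_gt0 : 0 < delta. Proof. exact: powR_gt0. Qed.

Let delta_exp : delta ^+ d = D.
Proof.
rewrite /delta -powR_mulrn ?powR_ge0 // -powRrM mulVf ?powRr1 ?(ltW D_gt0) //.
by rewrite pnatr_eq0; case: (d) d3.
Qed.

(** Row j encodes column j of B^-1, a vector of the trace-dual basis. The minus sign makes its dot
    product with (Re x, Im x) equal to the real part of sum_k (B^-1)_kj x_k. *)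
Let dualY : 'M[R]_(d, d + d) :=
  row_mx (\matrix_(j, k) ReC (invmx B k j)) (\matrix_(j, k) - complex.Im (invmx B k j)).

Let unitB : B \in unitmx. Proof. by rewrite unitmxE unitfE. Qed.

(* The Euclidean lattice with basis dualY is the trace dual of the ring of
   integers, whose nonzero elements have norm at least 1 / |D|. *)
Let dual_min : lattice_min_ge dualY (delta ^- 2).
Proof.
move=> m m0; pose yv := invmx B *m (intmx R[i] m)^T; pose y k := yv k 0.
have By : B *m yv = (intmx R[i] m)^T by rewrite mulKVmx.
have y_int j : exists z : int, \sum_k y k * B j k = z%:~R.
  exists (m 0 j); have /matrixP/(_ j 0) := By; rewrite mxE [RHS]mxE mxE => <-.
  by apply: eq_bigr => k _; rewrite mulrC.
have [k1 yk1] : exists k, y k != 0.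
  apply: contrapT => /forallNP y0; case/eqP: m0.
  have yv0 : yv = 0.
    by apply/colP => k; rewrite [RHS]mxE; apply/eqP/negPn/negP; apply: y0.
  apply/rowP => j; move/matrixP/(_ j 0): By; rewrite yv0 mulmx0 !mxE => /esym/eqP.
  by rewrite intr_eq0 => /eqP.
have yE : dotv (intmx R m *m dualY) (intmx R m *m dualY) = \sum_k absC (y k) ^+ 2.
  rewrite mul_mx_row dotvE big_split_ord /= -big_split /=; apply: eq_bigr => k _ /=.
  rewrite !row_mxEl !row_mxEr absC_sqr.
  rewrite (_ : y k = \sum_j invmx B k j * (intmx R[i] m)^T j 0); last by rewrite /y mxE.
  have -> : (intmx R m *m \matrix_(j, k) ReC (invmx B k j)) 0 k =
      ReC (\sum_j invmx B k j * (intmx R[i] m)^T j 0).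
    rewrite ReC_sum mxE; apply: eq_bigr => j _.
    rewrite !mxE mulrC -[_%:~R in RHS](rmorph_int (real_complex R)).
    by case: (invmx B k j) => a b; rewrite /ReC /=; ring.
  have -> : (intmx R m *m \matrix_(j, k) - complex.Im (invmx B k j)) 0 k =
      - complex.Im (\sum_j invmx B k j * (intmx R[i] m)^T j 0).
    rewrite ImC_sum mxE -sumrN; apply: eq_bigr => j _.
    rewrite !mxE mulrC -[_%:~R in RHS](rmorph_int (real_complex R)).
    by case: (invmx B k j) => a b /=; ring.
  by ring.
(* If the sum of squares were below delta^-2, every |y_k| would be below delta^-1 and the norm below
   1 / D, against [dual_norm_ge]. *)
rewrite yE leNgt; apply/negP => small.
have := dual_norm_ge minP sizeP int_lam enum_e basis_w y_int yk1.
apply/negP; rewrite -ltNge -/D mulrC -ltr_pdivlMr // mul1r -delta_exp -exprVn.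
rewrite -[X in _ < _ ^+ X]card_ord -prodr_const; apply: ltr_prod.
  by apply/hasP; exists k1; rewrite ?mem_index_enum.
move=> k _; rewrite absC_ge0 /= -(@ltr_pXn2r _ 2) // ?nnegrE ?absC_ge0 //.
  rewrite exprVn; apply: le_lt_trans small.
  by rewrite (bigD1 k) //= lerDl sumr_ge0 // => j _; rewrite exprn_ge0 ?absC_ge0.
by rewrite invr_ge0 ltW.
Qed.

(** Transference with s = delta^-2 gives squared norm at most (4^d - 1) delta^2 <= (2^d delta)^2.
    The solution, read as a vector [x'] of C^d, may lie outside K_R; the real parts of its
    coefficients are those of [X] modulo integers, and by [basis_mx_Re] they give a vector of K_R
    obeying the same bound. *)
Lemma KR_covering X : KR e X -> exists c : 'rV[int]_d,
  forall k, absC (X k - emb B c k) <= 2 ^+ d * delta.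
Proof.
have [cj _ cjE] := exists_cj sizeP enum_e.
move=> /KR_coord[t tE].
have s0 : 0 < delta ^- 2 by rewrite invr_gt0 exprn_gt0.
have [x [z [xb xE]]] := solves_mod1_transference s0 dual_min (\col_j t j).
pose x' (k : 'I_d) : R[i] := (x 0 (lshift d k) +i* x 0 (rshift d k))%C.
pose s := (\row_k x' k) *m invmx B.
have sE j : ReC (s 0 j) = t j + (z j 0)%:~R.
  have /matrixP/(_ j 0) := xE; rewrite [RHS]mxE 2![in RHS]mxE => <-.
  rewrite !mxE ReC_sum big_split_ord /= -big_split /=; apply: eq_bigr => k _ /=.
  rewrite row_mxEl row_mxEr !mxE.
  by case: (invmx B k j) => a b; rewrite /ReC /=; ring.
have sB k : \sum_j s 0 j * B j k = x' k.
  have : (s *m B) 0 k = x' k by rewrite mulmxKV // mxE.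
  by rewrite mxE.
have M0 : 0 <= 2 ^+ d * delta by rewrite mulr_ge0 ?exprn_ge0 ?ltW.
have x'_le k : absC (x' k) <= 2 ^+ d * delta.
  rewrite -(@ler_pXn2r _ 2) ?nnegrE ?absC_ge0 //.
  apply: (@le_trans _ _ (dotv x x)).
    rewrite absC_sqr !expr2 dotvE big_split_ord /= -big_split /= (bigD1 k) //= lerDl.
    by rewrite sumr_ge0 // => j _; rewrite addr_ge0 // -expr2 sqr_ge0.
  apply: le_trans xb _; rewrite invrK exprMn -exprM mulnC exprM.
  rewrite (_ : 2 ^+ 2 = 4); last by ring.
  by rewrite ler_wpM2r ?exprn_ge0 ?ltW //; lra.
exists (- z^T) => k.
have -> : X k - emb B (- z^T) k = \sum_j Cof (ReC (s 0 j)) * B j k.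
  rewrite tE embE -sumrB; apply: eq_bigr => j _; rewrite sE /Cof rmorphD /=.
  by rewrite !mxE mulrNz mulNr opprK mulrDl rmorph_int.
rewrite -(@ler_pM2l _ 2) // -{1}(@absC_ge0_Cof R 2) // -absCM [Cof 2](rmorph_nat (real_complex R)).
rewrite (basis_mx_Re _ _ cjE) !sB.
apply: le_trans (absCD _ _) _; rewrite absC_conj.
by have := x'_le k; have := x'_le (cj k); lra.
Qed.

Lemma dPFirr_le_disc :
  dPFirr_le lam ((8 * d%:R / (1 - rho)) ^+ (d ^ 2) * Num.sqrt (absC (discK e w))).
Proof.
have := @dPFirr_le_radii (fun=> 2 ^+ d * delta).
rewrite prodr_const card_ord (exprMn d (2 ^+ d) delta) delta_exp => main.
apply: dPFirr_le_trans (main _ _ _); last exact: KR_covering.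
- have rho1 : 0 <= 1 - rho by have /andP[_ lt1] := spectral_ratio_itv; rewrite subr_ge0 ltW.
  rewrite discKE sqrtr_sqr ger0_norm ?absC_ge0 // /D (expr2 (absC _)).
  rewrite -(mulrA ((2 ^+ d) ^+ d)) mulfK ?gt_eqF // mulrA ler_wpM2r ?absC_ge0 //.
  rewrite -exprMn -mulnn exprM; apply: lerXn2r; rewrite ?nnegrE.
  + by rewrite mulr_ge0 ?exprn_ge0 // divr_ge0 ?mulr_ge0 ?exprn_ge0.
  + by rewrite exprn_ge0 // divr_ge0 ?mulr_ge0.
  by apply: final_constant_le => //; apply: spectral_ratio_itv.
- by move=> _; rewrite mulr_gt0 ?exprn_gt0.
- by [].
Qed.

(** * The thickness bound *)

Lemma qform_diag (a : 'I_d -> R) (x : 'I_d -> R[i]) :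
  qform a x x = \sum_k a k * absC (x k) ^+ 2.
Proof.
rewrite /qform ReC_sum; apply: eq_bigr => k _; rewrite -[_^*]/(conjc _) absC_sqr.
by case: (x k) => b c; rewrite /ReC /=; ring.
Qed.

(** The Gram matrix is B diag(a) B^*. The real part taken in [qform] changes nothing, because
    conjugation permutes the terms of the sum. *)
Lemma detOKE (a : 'I_d -> R) : Bset e a -> detOK e w a = \prod_k a k * D.
Proof.
move=> [_ aconj]; have [cj cjK cjE] := exists_cj sizeP enum_e.
apply: complexI; rewrite -det_map_mx.
have -> : map_mx (real_complex R) (\matrix_(i, j) qform a
    (fun k => evC (w i) (e k)) (fun k => evC (w j) (e k))) =
    B *m diag_mx (\row_k Cof (a k)) *m (map_mx Num.conj B)^T.
  apply/matrixP => i j; rewrite !mxE /qform /ReC.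
  set S := \sum_(k < d) _; have -> : ((complex.Re S)%:C)%C = S.
    apply: RRe_real; apply/CrealP; rewrite /S rmorph_sum /=.
    rewrite [RHS](reindex_inj (can_inj cjK)); apply: eq_bigr => k _ /=.
    rewrite !rmorphM /= (aconj k) // cjE !evC_conj.
    by rewrite -[(Cof _)^*]/(conjc (Cof _)) conjc_real.
  apply: eq_bigr => k _; rewrite mul_mx_diag !mxE; ring.
rewrite !det_mulmx det_tr det_diag det_map_mx /= mulrAC -normCK mulrC.
rewrite rmorphM rmorph_prod rmorphXn /= -absCE; congr (_ * _).
by apply: eq_bigr => k _; rewrite mxE.
Qed.

Lemma emb_OK c : OK_emb lam e (emb B c).
Proof.
exists (\sum_j (c 0 j)%:~R *: w j); split.
  rewrite /evR rmorph_sum horner_sum.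
  apply: (big_ind (fun x : R => is_alg_int x)) => [|x y|j _].
  - by apply/alg_intP/integral0.
  - by rewrite !alg_intP; apply: integral_add.
  rewrite /= map_polyZ hornerZ /= ratr_int; apply: alg_intM.
    by apply/alg_intP; apply: integral_id.
  exact: w_alg_int basis_w j.
apply/funext => k; rewrite embE /evC rmorph_sum horner_sum.
by apply: eq_bigr => j _; rewrite /= map_polyZ hornerZ /= ratr_int !mxE.
Qed.

Section Weight.
Variable a : 'I_d -> R.
Hypothesis Ba : Bset e a.

Let a_gt0 k : 0 < a k. Proof. by case: Ba. Qed.

Let qform_ge0 x : 0 <= qform a x x.
Proof.
rewrite qform_diag sumr_ge0 // => k _.
by rewrite mulr_ge0 ?exprn_ge0 ?absC_ge0 // ltW.
Qed.

Definition covering_values : set R := [set u : R | forall x, KR e x ->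
  exists2 y, OK_emb lam e y &
    qform a (fun k => x k - y k) (fun k => x k - y k) <= u]%classic.

Lemma covering_values_ge0 u : covering_values u -> 0 <= u.
Proof.
move=> /(_ (fun=> 0)) [|y _]; first by move=> i j _; rewrite rmorph0.
exact: le_trans.
Qed.

(** Ensures that [maxOK] is a genuine infimum and not the default value of [inf] on the empty
    set. *)
Lemma covering_values_nonempty : (covering_values !=set0)%classic.
Proof.
exists (\sum_k a k * (2 ^+ d * delta) ^+ 2) => X /KR_covering[c cX].
exists (emb B c); first exact: emb_OK.
rewrite qform_diag; apply: ler_sum => k _; rewrite ler_pM2l //.
by apply: lerXn2r; rewrite ?nnegrE ?absC_ge0 // (le_trans _ (cX k)) ?absC_ge0.
Qed.

Lemma maxOK_ge0 : 0 <= maxOK lam e a.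
Proof.
by apply: lb_le_inf; [exact: covering_values_nonempty | exact: covering_values_ge0].
Qed.

(** With u = t det^(1/d) above max(O_K, q_a), a lattice point at q-distance at most u is within r_k
    = sqrt (u / a_k) in each coordinate. The square of prod_k r_k / |det B| is u^d / det = t^d. *)
Lemma dPFirr_le_thickness t : thickness lam e w a < t ->
  dPFirr_le lam ((33 * d%:R ^+ 2 / (1 - rho)) ^+ d * Num.sqrt t ^+ d).
Proof.
have A0 : 0 < \prod_k a k by apply: prodr_gt0.
have dO : 0 < detOK e w a by rewrite detOKE // mulr_gt0.
have p0 : 0 < detOK e w a `^ d%:R^-1 by apply: powR_gt0.
rewrite /thickness ltr_pdivrMr //; set u := t * _ => max_u.
have [v vS vu] := inf_lt covering_values_nonempty max_u.
have u0 : 0 < u by apply: le_lt_trans vu; apply: covering_values_ge0.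
have t0 : 0 <= t by rewrite -(pmulr_lge0 _ p0) ltW.
pose r k := Num.sqrt (u / a k).
have r0 k : 0 < r k by rewrite sqrtr_gt0 divr_gt0.
have -> : Num.sqrt t ^+ d = \prod_k r k / absC (\det B).
  apply/eqP; rewrite -(@eqrXn2 _ 2) //; last 2 first.
  - by rewrite exprn_ge0 // sqrtr_ge0.
  - by rewrite divr_ge0 ?absC_ge0 // prodr_ge0 // => k _; apply: ltW.
  rewrite expr_div_n -/D -prodrXl -exprM mulnC exprM sqr_sqrtr //.
  rewrite (eq_bigr (fun k => u * (a k)^-1)); last first.
    by move=> k _; rewrite sqr_sqrtr // ltW // divr_gt0.
  rewrite big_split /= prodr_const card_ord prodfV -mulrA -invfM -detOKE //.
  rewrite /u exprMn -[(detOK e w a `^ _) ^+ d]powR_mulrn ?powR_ge0 // -powRrM mulVf.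
    by rewrite powRr1 ?(ltW dO) // mulfK // gt_eqF.
  by rewrite pnatr_eq0; case: (d) d3.
apply: dPFirr_le_radii => //.
  by move=> i j eij; rewrite /r; case: Ba => _ /(_ i j eij) ->.
move=> X /vS[y [p [ip yE]] qv].
have [c cE] := alg_int_emb minP enum_e basis_w ip.
exists c => k; rewrite -cE; have -> : evC p (e k) = y k by rewrite yE.
rewrite -[leLHS]ger0_norm ?absC_ge0 // -sqrtr_sqr /r ler_wsqrtr //.
rewrite ler_pdivlMr // mulrC; apply: le_trans (ltW vu); apply: le_trans qv.
rewrite qform_diag (bigD1 k) //= lerDl sumr_ge0 // => j _.
by rewrite mulr_ge0 ?exprn_ge0 ?absC_ge0 // ltW.
Qed.

End Weight.

Lemma dPFirr_le_tau_min :
  dPFirr_le lam ((8 * d%:R / (1 - rho)) ^+ (d ^ 2) * tau_min lam e w `^ (d%:R / 2)).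
Proof.
set tau := tau_min _ _ _; pose C := 33 * d%:R ^+ 2 / (1 - rho).
have /andP[rho0 rho1] := spectral_ratio_itv.
have rho1' : 0 < 1 - rho by rewrite subr_gt0.
have d0 : 0 < d%:R :> R by rewrite ltr0n; case: (d) d3.
have C0 : 0 < C by rewrite divr_gt0 // mulr_gt0 // exprn_gt0.
have tau_ne : ([set t : R | exists2 a, Bset e a & t = thickness lam e w a] !=set0)%classic.
  by exists (thickness lam e w (fun=> 1)), (fun=> 1).
have bound t : tau < t -> dPFirr_le lam ((C * Num.sqrt t) ^+ d).
  move=> tau_t; rewrite exprMn; have [_ [a Ba ->]] := inf_lt tau_ne tau_t.
  exact: dPFirr_le_thickness.
have tau0 : 0 <= tau.
  apply: lb_le_inf => // _ [a Ba ->].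
  by rewrite divr_ge0 ?maxOK_ge0 ?powR_ge0.
(* A matrix has dimension at least 1, so the bounds obtained for t > tau cannot
   tend to 0. *)
have tau_gt0 : 0 < tau.
  rewrite lt_def tau0 andbT; apply/eqP => tauE.
  (* For this value of t the dimension bound is 2^-d, which is below 1. *)
  have /bound/dPFirr_le_ge1 : tau < (2 * C) ^- 2.
    by rewrite tauE invr_gt0 exprn_gt0 // mulr_gt0.
  rewrite -exprVn sqrtr_sqr gtr0_norm; last by rewrite invr_gt0 mulr_gt0.
  rewrite invfM mulrCA mulfV ?gt_eqF // mulr1 exprVn invf_ge1 ?exprn_gt0 //.
  have d_neq0 : d != 0%N by case: (d) d3.
  by rewrite leNgt exprn_egt1 ?d_neq0 ?ltr1n.
(* The value 4 tau avoids asking whether the infimum is attained; it costs a factor 2 under the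
   power d, within the 2^d of [final_constant_le]. *)
have /bound main : tau < 4 * tau.
  by rewrite -[X in X < _]mul1r ltr_pM2r // (ltr_nat _ 1).
apply: dPFirr_le_trans main.
have sqrt4 : Num.sqrt (4 * tau) = 2 * Num.sqrt tau.
  rewrite sqrtrM // (_ : 4 = 2 ^+ 2); last by ring.
  by rewrite sqrtr_sqr ger0_norm.
have -> : tau `^ (d%:R / 2) = Num.sqrt tau ^+ d.
  by rewrite mulrC powRrM powR12_sqrt // powR_mulrn // sqrtr_ge0.
rewrite sqrt4 mulrA exprMn ler_wpM2r ?exprn_ge0 ?sqrtr_ge0 //.
rewrite -mulnn exprM; apply: lerXn2r; rewrite ?nnegrE.
- by rewrite mulr_ge0 // ltW.
- by rewrite exprn_ge0 // divr_ge0 ?mulr_ge0 // ltW.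
apply: le_trans (final_constant_le d3 spectral_ratio_itv).
rewrite ler_pM2l // -[X in X <= _]expr1 ler_weXn2l //; last by case: (d) d3.
by rewrite (ler_nat _ 1).
Qed.

End Main.

Theorem theorem1p3 (R : realType) (lam : R) (P : {poly rat}) (d : nat) (rho : R)
  (e : 'I_d -> R[i]) (w : 'I_d -> {poly rat}) :
  is_minpoly P lam -> size P = d.+1 -> (3 <= d)%N ->
  is_Perron P lam -> is_spectral_ratio P lam rho ->
  is_embedding_enum P e -> is_Zbasis lam w ->
  dPFirr_le lam ((8 * d%:R / (1 - rho)) ^+ (d ^ 2) * (tau_min lam e w) `^ (d%:R / 2)) /\
  dPFirr_le lam ((8 * d%:R / (1 - rho)) ^+ (d ^ 2) * Num.sqrt (absC (discK e w))).
Proof.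
move=> minP sizeP d3 perron ratio enum_e basis_w; split.
  exact: dPFirr_le_tau_min minP sizeP d3 perron ratio enum_e basis_w.
exact: dPFirr_le_disc minP sizeP d3 perron ratio enum_e basis_w.
Qed.
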